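(* Consider a misanthropes process (MP) on $\mathbb Z^d$ with rates $p(x,y)g^1_{\alpha,\beta}$ satisfying: there is $C>0$ with $\sum_{k=1}^\alpha k g^k_{\alpha,\beta}=g^1_{\alpha,\beta}\le C(\alpha+\beta)$ for all $\alpha>0,\beta\ge0$. Assume that the rates $(g^1_{1,\alpha})_{\alpha\ge0}$ and $(g^1_{\alpha,0})_{\alpha\ge1}$ are positive. Let $\bar\mu$ be a translation-invariant product probability measure on $\mathbb N^{\mathbb Z^d}$ whose single site marginal $\mu$ satisfies $\mu(\alpha)>0$ for all $\alpha\in\mathbb N$, and such that either $\mu$ has a finite first moment or the alternative assumptions (A1)–(A2) (stated in the context) hold. Then $\bar\mu$ is invariant for the MP if and only if $$\mu(\alpha)=\mu(0)\prod_{k=1}^\alpha\Big[\frac{\mu(1)}{\mu(0)}\frac{g^1_{1,k-1}}{g^1_{k,0}}\Big]\quad\text{for all }\alpha\ge1,$$ and the following compatibility conditions hold: if $p(\cdot,\cdot)$ is symmetric, $$g^1_{\alpha+1,\beta}=\frac{g^1_{\alpha+1,0}}{g^1_{1,\alpha}}\,\frac{g^1_{1,\beta}}{g^1_{\beta+1,0}}\,g^1_{\beta+1,\alpha}\quad\text{for all }\alpha,\beta\ge0;$$ if $p(\cdot,\cdot)$ is asymmetric, the previous identity together with $$g^1_{\beta,\alpha}=g^1_{\alpha,\beta}+g^1_{\beta,0}-g^1_{\alpha,0}\quad\text{for all }\alpha,\beta\ge0.$$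
   Context: $\mathbb N=\{0,1,2,\dots\}$ and $X=\mathbb Z^d$. Mass migration process (MMP): $p(\cdot,\cdot)$ is an irreducible translation-invariant transition probability on $\mathbb Z^d$ (symmetric if $p(x,y)=p(y,x)$ for all $x,y$, asymmetric otherwise). The rates are numbers $g^k_{\alpha,\beta}\ge0$ with $g^0_{\alpha,\beta}=0$ and $g^k_{\alpha,\beta}=0$ if $k>\alpha$ or $\alpha=0$; $k$ particles jump together from $x$ to $y$ at rate $p(x,y)g^k_{\eta(x),\eta(y)}$. A misanthropes process (MP) is the single-jump case $g^k_{\alpha,\beta}=0$ for $k>1$ (no monotonicity of $g^1$ is required). Fix a positive function $a$ on $X$ and $M>0$ with $\sum_yp(x,y)a_y+\sum_ya_yp(y,x)\le Ma_x$ for all $x$, and $\sum_xa_x<\infty$. Set $\|\eta\|=\sum_x\eta(x)a_x$, $\|\eta-\zeta\|=\sum_x|\eta(x)-\zeta(x)|a_x$, $\mathfrak X=\{\eta\in\mathbb N^X:\|\eta\|<\infty\}$, and let $\mathbf L$ be the set of $f:\mathfrak X\to\mathbb R$ such that $|f(\eta)-f(\zeta)|\le L_f\|\eta-\zeta\|$ for some $L_f>0$. Generator: $\mathcal Lf(\eta)=\sum_{x,y}\sum_{k>0}p(x,y)g^k_{\eta(x),\eta(y)}\big(f(\mathcal S^k_{x,y}\eta)-f(\eta)\big)$, where $\mathcal S^k_{x,y}\eta$ is $\eta$ with $k$ particles moved from $x$ to $y$ if $\eta(x)\ge k$ and $x\neq y$, and $\eta$ otherwise. The process is assumed constructed, i.e.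 there is a Markov semigroup $(S(t))_{t\ge0}$ on $\mathbf L$ such that for $f\in\mathbf L$, $\eta\in\mathfrak X$: $S(t_1+t_2)=S(t_1)S(t_2)$, $S(0)=I$; $S(t)f(\eta)=f(\eta)+\int_0^t\mathcal LS(s)f(\eta)\,ds$; $|S(t)f(\eta)-f(\eta)|\le\|\eta\|L_f(e^{ct}-1)$ for a constant $c>0$; $S(t)f(\eta)$ and $\mathcal LS(t)f(\eta)$ are continuous in $t$; $\lim_{t\searrow0}(S(t)f(\eta)-f(\eta))/t=\mathcal Lf(\eta)$; $\mathcal LS(t)f(\eta)=S(t)\mathcal Lf(\eta)$. (Under (A1) below another construction of the semigroup is allowed.) A probability measure $\bar\mu$ on $\mathbb N^X$ is invariant if it is supported on $\mathfrak X$ and $\int S(t)f\,d\bar\mu=\int f\,d\bar\mu$ for every bounded $f\in\mathbf L$ and $t\ge0$. Alternative assumptions: (A1) a probability measure $\bar\mu$ on $\mathbb N^X$ is called invariant when $\int S(t)f\,d\bar\mu=\int f\,d\bar\mu$ for every bounded $f\in\mathbf L$, $t\ge0$, and this is equivalent to $\int\mathcal Lf\,d\bar\mu=0$ for every bounded cylinder function $f$ on $\mathbb N^X$; (A2) there is $C>0$ with $\sum_{k\le\alpha}g^k_{\alpha,\beta}\le C$ for all $\alpha,\beta$. *)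

(* Defs.v *)
From HB Require Import structures.
From mathcomp Require Import all_boot all_order all_algebra.
From mathcomp Require Import all_classical all_reals all_analysis.

Set Implicit Arguments.
Unset Strict Implicit.
Unset Printing Implicit Defensive.

Import Order.TTheory GRing.Theory Num.Theory.
Import numFieldNormedType.Exports.

Local Open Scope classical_set_scope.
Local Open Scope ring_scope.

Notation site d := 'rV[int]_d.

Definition coordinate_events (d : nat) : set (set (site d -> nat)) :=
  [set A | exists x n, A = [set eta | eta x = n]].

(* N^(Z^d) with its product sigma-algebra (N being discrete). *)
Notation config d := (g_sigma_algebraType (@coordinate_events d)).

(* Sum of a real family indexed by an arbitrary (countable) set; it has its
   usual meaning when the family is absolutely summable. *)
Definition rsum (R : realType) (I : choiceType) (F : I -> R) : R :=
  fine (\esum_(i in [set: I]) (EFin \o F)^\+ i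
        - \esum_(i in [set: I]) (EFin \o F)^\- i)%E.

Section TransitionProbability.
Variables (R : realType) (d : nat) (p : site d -> site d -> R).

Definition translation_invariant_kernel : Prop :=
  forall x y z, p (x + z) (y + z) = p x y.

Definition irreducible_kernel : Prop :=
  forall x y, exists2 s : seq (site d),
    path (fun u v => 0 < p u v) x s & last x s = y.

Definition symmetric_kernel : Prop := forall x y, p x y = p y x.

Record transition_kernel : Prop := TransitionKernel {
  tk_ge0 : forall x y, 0 <= p x y;
  tk_sum1 : forall x, \esum_(y in [set: site d]) (p x y)%:E = 1%E;
  tk_translation : translation_invariant_kernel;
  tk_irreducible : irreducible_kernel
}.

Record weight (a : site d -> R) (M : R) : Prop := Weight {
  weight_gt0 : forall x, 0 < a x;
  weight_bound_gt0 : 0 < M;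
  weight_bound : forall x,
    (\esum_(y in [set: site d]) (p x y * a y)%:E
     + \esum_(y in [set: site d]) (a y * p y x)%:E <= (M * a x)%:E)%E;
  weight_summable : (\esum_(x in [set: site d]) (a x)%:E < +oo)%E
}.

End TransitionProbability.

(* g k alpha beta is the rate written g^k_{alpha,beta}. *)
Section Rates.
Variables (R : realType) (g : nat -> nat -> nat -> R).

Record mmp_rates : Prop := MmpRates {
  rates_ge0 : forall k alpha beta, 0 <= g k alpha beta;
  rates_k0 : forall alpha beta, g 0 alpha beta = 0;
  rates_overflow : forall k alpha beta, (alpha < k)%N -> g k alpha beta = 0;
  rates_empty : forall k beta, g k 0 beta = 0
}.

Definition single_jump : Prop :=
  forall k alpha beta, (1 < k)%N -> g k alpha beta = 0.

Definition linear_growth : Prop :=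
  exists2 C : R, 0 < C & forall alpha beta, (0 < alpha)%N ->
    \sum_(1 <= k < alpha.+1) k%:R * g k alpha beta <= C * (alpha + beta)%:R.

Definition bounded_rates : Prop :=
  exists2 C : R, 0 < C & forall alpha beta,
    \sum_(k < alpha.+1) g k alpha beta <= C.

End Rates.

Section StateSpace.
Variables (R : realType) (d : nat) (a : site d -> R).

Definition config_norm (eta : config d) : \bar R :=
  \esum_(x in [set: site d]) ((eta x)%:R * a x)%:E.

Definition config_dist (eta zeta : config d) : \bar R :=
  \esum_(x in [set: site d]) (`|(eta x)%:R - (zeta x)%:R| * a x)%:E.

Definition finite_norm_configs : set (config d) :=
  [set eta | (config_norm eta < +oo)%E].

(* A function on E is represented by a function on all configurations of which
   only the values on E matter.  When [config_dist eta zeta] is infinite, which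
   never happens on [finite_norm_configs], the condition is void. *)
Definition lipschitz_with (E : set (config d)) (f : config d -> R) (L : R) :=
  forall eta zeta, E eta -> E zeta ->
    (`|f eta - f zeta|%:E <= L%:E * config_dist eta zeta)%E.

Definition lipschitz_functions (E : set (config d)) : set (config d -> R) :=
  [set f | exists2 L, 0 < L & lipschitz_with E f L].

Definition bounded_function (E : set (config d)) (f : config d -> R) : Prop :=
  exists B : R, forall eta, E eta -> `|f eta| <= B.

Definition cylinder_function (f : config d -> R) : Prop :=
  exists F : seq (site d), forall eta zeta : config d,
    (forall x, x \in F -> eta x = zeta x) -> f eta = f zeta.

End StateSpace.

Section Dynamics.
Variables (R : realType) (d : nat).
Variables (p : site d -> site d -> R) (g : nat -> nat -> nat -> R).

Definition migrate (k : nat) (x y : site d) (eta : config d) : config d :=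
  if (k <= eta x)%N && (x != y) then
    fun z => if z == x then (eta x - k)%N
             else if z == y then (eta y + k)%N else eta z
  else eta.

(* The sum over k > 0 stops at [eta x] since g^k_{alpha,beta} = 0 for
   k > alpha. *)
Definition generator (f : config d -> R) (eta : config d) : R :=
  rsum (fun xy : site d * site d =>
    \sum_(1 <= k < (eta xy.1).+1)
      p xy.1 xy.2 * g k (eta xy.1) (eta xy.2)
        * (f (migrate k xy.1 xy.2 eta) - f eta)).

(* A Markov semigroup on the class D of functions on E. *)
Record markov_semigroup (E : set (config d)) (D : set (config d -> R))
    (S : R -> (config d -> R) -> config d -> R) : Prop := MarkovSemigroup {
  ms_stable : forall t f, 0 <= t -> D f -> D (S t f);
  ms_local : forall t f h, 0 <= t -> D f -> D h ->
    (forall eta, E eta -> f eta = h eta) ->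
    forall eta, E eta -> S t f eta = S t h eta;
  ms_id : forall f eta, D f -> E eta -> S 0 f eta = f eta;
  ms_comp : forall t1 t2 f eta, 0 <= t1 -> 0 <= t2 -> D f -> E eta ->
    S (t1 + t2) f eta = S t1 (S t2 f) eta;
  ms_linear : forall t c f h eta, 0 <= t -> D f -> D h -> E eta ->
    S t (fun xi => c * f xi + h xi) eta = c * S t f eta + S t h eta;
  ms_conservative : forall t eta, 0 <= t -> E eta -> S t (fun=> 1) eta = 1;
  ms_positive : forall t f, 0 <= t -> D f ->
    (forall eta, E eta -> 0 <= f eta) -> forall eta, E eta -> 0 <= S t f eta
}.

(* The semigroup of the process with generator [generator]; [lipschitz_with]
   is stable under enlarging L, so the bound in [mmp_modulus] is the one for
   every admissible Lipschitz constant. *)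
Record mmp_semigroup (a : site d -> R)
    (S : R -> (config d -> R) -> config d -> R) : Prop := MmpSemigroup {
  mmp_markov : markov_semigroup (finite_norm_configs a)
    (lipschitz_functions a (finite_norm_configs a)) S;
  mmp_integral : forall t f eta, 0 <= t ->
    lipschitz_functions a (finite_norm_configs a) f ->
    finite_norm_configs a eta ->
    S t f eta = f eta +
      (\int[lebesgue_measure]_(s in `[0%R, t]) generator (S s f) eta)%R;
  mmp_modulus : exists2 c : R, 0 < c & forall t f L eta, 0 <= t -> 0 < L ->
    lipschitz_with a (finite_norm_configs a) f L ->
    finite_norm_configs a eta ->
    `|S t f eta - f eta|
      <= fine (config_norm a eta) * L * (expR (c * t) - 1);
  mmp_continuous : forall f eta,
    lipschitz_functions a (finite_norm_configs a) f ->
    finite_norm_configs a eta ->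
    {within `[0%R, +oo[, continuous (fun t : R => S t f eta)};
  mmp_generator_continuous : forall f eta,
    lipschitz_functions a (finite_norm_configs a) f ->
    finite_norm_configs a eta ->
    {within `[0%R, +oo[, continuous (fun t : R => generator (S t f) eta)};
  mmp_derivative : forall f eta,
    lipschitz_functions a (finite_norm_configs a) f ->
    finite_norm_configs a eta ->
    (S t f eta - f eta) / t @[t --> 0^'+] --> generator f eta;
  mmp_commute : forall t f eta, 0 <= t ->
    lipschitz_functions a (finite_norm_configs a) f ->
    finite_norm_configs a eta ->
    generator (S t f) eta = S t (generator f) eta
}.

Definition invariant_measure (a : site d -> R)
    (S : R -> (config d -> R) -> config d -> R)
    (P : probability (config d) R) : Prop :=
  P (finite_norm_configs a) = 1%E /\
  forall f, lipschitz_functions a (finite_norm_configs a) f ->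
    bounded_function (finite_norm_configs a) f ->
    forall t, 0 <= t ->
    (\int[P]_(eta in finite_norm_configs a) (S t f eta)%:E
     = \int[P]_(eta in finite_norm_configs a) (f eta)%:E)%E.

(* Test functions for invariance when the measure need not be supported on
   configurations of finite norm: measurability, automatic on
   [finite_norm_configs], has to be required on the whole space. *)
Definition full_test_functions (a : site d -> R) : set (config d -> R) :=
  [set f | [/\ lipschitz_functions a setT f, bounded_function setT f
             & measurable_fun setT f]].

Definition full_invariant_measure (a : site d -> R)
    (S : R -> (config d -> R) -> config d -> R)
    (P : probability (config d) R) : Prop :=
  forall f, full_test_functions a f -> forall t, 0 <= t ->
    (\int[P]_eta (S t f eta)%:E = \int[P]_eta (f eta)%:E)%E.

(* Any construction on N^(Z^d) is allowed: S is a Markov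
   semigroup on some linear space D of bounded measurable functions containing
   the test functions, for which invariance is characterized by the generator
   on bounded cylinder functions. *)
Definition alternative_construction (a : site d -> R)
    (S : R -> (config d -> R) -> config d -> R) : Prop :=
  (exists D : set (config d -> R),
    [/\ forall f, full_test_functions a f -> D f,
        forall f, D f -> bounded_function setT f /\ measurable_fun setT f,
        forall c f h, D f -> D h -> D (fun eta => c * f eta + h eta)
      & markov_semigroup setT D S]) /\
  forall Q : probability (config d) R,
    full_invariant_measure a S Q <->
    (forall f, bounded_function setT f -> cylinder_function f ->
      (\int[Q]_eta (generator f eta)%:E = 0)%E).

End Dynamics.

Section ProductMeasure.
Variables (R : realType) (d : nat) (P : probability (config d) R).

Definition translation_invariant_measure : Prop :=
  forall (z : site d) (A : set (config d)), measurable A ->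
    P [set eta | A (fun x => eta (x + z))] = P A.

Definition product_measure : Prop :=
  forall (F : seq (site d)) (A : site d -> set nat), uniq F ->
    fine (P [set eta | forall x, x \in F -> A x (eta x)])
    = \prod_(x <- F) fine (P [set eta | A x (eta x)]).

Definition marginal (alpha : nat) : R :=
  fine (pushforward P (fun eta : config d => eta 0) [set alpha]).

Definition finite_first_moment : Prop :=
  (\sum_(0 <= alpha <oo) (alpha%:R * marginal alpha)%:E < +oo)%E.

End ProductMeasure.

Section Conditions.
Variables (R : realType) (g : nat -> nat -> nat -> R).

Definition product_form (mu : nat -> R) : Prop :=
  forall alpha, (1 <= alpha)%N ->
    mu alpha = mu 0%N *
      \prod_(1 <= k < alpha.+1)
        (mu 1%N / mu 0%N * (g 1 1 k.-1 / g 1 k 0%N)).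

Definition symmetric_compatibility : Prop :=
  forall alpha beta : nat,
    g 1 alpha.+1 beta
    = g 1 alpha.+1 0%N / g 1 1 alpha * (g 1 1 beta / g 1 beta.+1 0%N)
      * g 1 beta.+1 alpha.

Definition asymmetric_compatibility : Prop :=
  forall alpha beta : nat,
    g 1 beta alpha = g 1 alpha beta + g 1 beta 0%N - g 1 alpha 0%N.

End Conditions.

(* Main.v *)
Require Import Defs.
From HB Require Import structures.
From mathcomp Require Import all_boot all_order all_algebra.
From mathcomp Require Import all_classical all_reals all_analysis.
From mathcomp Require Import measurable_realfun.
From mathcomp Require Import ring lra.
Set Implicit Arguments.
Unset Strict Implicit.
Unset Printing Implicit Defensive.
Import Order.TTheory GRing.Theory Num.Theory.
Import numFieldNormedType.Exports.
Local Open Scope classical_set_scope.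
Local Open Scope ring_scope.

(** Write w(a, b) = g^1_{a,b} mu(a) mu(b) for the weight of a jump between two
    sites carrying a and b particles.  Everything rests on the identity

      E(L f) = sum over (x, y) of p(x, y) E(g^1_{eta(x),eta(y)} (f(S_xy eta) - f(eta)))

    for bounded cylinder functions f ([integral_generator]), whose terms are
    called mean fluxes below.

    Sufficiency.  The product form together with the first compatibility
    condition is the detailed balance w(a+1, b) = w(b+1, a).  Summing over the
    occupation numbers of x and y, it turns the mean flux through (x, y) into
    p(x, y) E((g^1_{eta(y),eta(x)} - g^1_{eta(x),eta(y)}) f)
    ([integral_reversal]).  If p is symmetric, this is antisymmetric in (x, y)
    and the sum vanishes.  Otherwise the second compatibility condition makes it
    p(x, y) (phi(y) - phi(x)), where phi(x) is the covariance of
    g^1_{eta(x),0} and f: by independence phi has finite support, and because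
    rows and columns of p both sum to 1 the total vanishes ([rsum_transport]).

    Necessity.  Take f to be the indicator of eta(0) = a: the mean out-flux
    and the mean in-flux that it sees are opposite ([flux_antisym]).  Then take
    the indicator of eta(0) = a, eta(z) = b and subtract mu(b) and mu(a) times the two
    one-site equations: by independence only the pairs (0, z) and (z, 0)
    survive, which leaves p(0, z) G(a, b) + p(z, 0) G(b, a) = 0
    ([excess_eq]).  In either case G(a, b) + G(b, a) = 0, which by induction on a
    is detailed balance, and for asymmetric p moreover G = 0, which yields the
    second compatibility condition.

    Invariance against E(L f) = 0.  Under the alternative assumptions the
    equivalence is given.  Under a finite first moment the norm is integrable,
    and it dominates the difference quotients of t -> S(t) f; differentiating
    at 0 gives one direction ([stationary_of_invariant]).  Conversely L f has
    mean 0 for every bounded Lipschitz f, by truncation to finite windows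
    ([lipschitz_generator_eq0]), so t -> E(S(t) f) is continuous with zero right
    derivative, hence constant ([invariant_of_stationary]). *)

(** * Absolutely convergent sums over a countable type *)

Section Sums.
Variables (R : realType) (I : countType).
Implicit Types (F G : I -> R).

(** The family [F] listed along the codes of its indices, with value [z] at the
    integers that code no index: series over [nat] and the counting measure
    then apply to families over any countable type. *)
Definition enumerated (T : Type) (z : T) (F : I -> T) (n : nat) : T :=
  oapp F z (pickle_inv n).

Lemma esum_enumerated (F : I -> \bar R) : (forall i, (0 <= F i)%E) ->
  \esum_(i in [set: I]) F i = (\sum_(n <oo) enumerated 0%E F n)%E.
Proof.
move=> F0.
have E0 n : (0 <= enumerated 0%E F n)%E.
  by rewrite /enumerated; case: pickle_inv => //=.
rewrite nneseries_esumT//.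
rewrite (esumID (range (@pickle I)) setT) //=.
rewrite [X in (_ + X)%E]esum1 ?adde0; last first.
  move=> n [_ nr]; rewrite /enumerated.
  case e : (pickle_inv n) => [i|] //=; exfalso; apply: nr.
  by exists i => //; have := @pickle_invK I n; rewrite e.
rewrite setTI esum_image; first by apply: eq_esum => i _; rewrite /enumerated pickleK_inv.
by move=> i j _ _; apply: (pcan_inj (@pickleK_inv I)).
Qed.

Lemma esumZl (F : I -> \bar R) (c : R) : (forall i, (0 <= F i)%E) -> 0 <= c ->
  \esum_(i in [set: I]) (c%:E * F i)%E = (c%:E * \esum_(i in [set: I]) F i)%E.
Proof.
move=> F0 c0; rewrite !esum_enumerated //; last by move=> i; apply: mule_ge0.
rewrite -nneseriesZl.
  by apply: eq_eseriesr => n _; rewrite /enumerated; case: pickle_inv => //=; rewrite mule0.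
by move=> n _; rewrite /enumerated; case: pickle_inv => //=.
Qed.

Lemma ge0_integral_esum d (T : measurableType d) (mu : {measure set T -> \bar R})
    (D : set T) (f : I -> T -> \bar R) : measurable D ->
  (forall i, measurable_fun D (f i)) -> (forall i x, (0 <= f i x)%E) ->
  (\int[mu]_(x in D) (\esum_(i in [set: I]) f i x))%E
  = \esum_(i in [set: I]) (\int[mu]_(x in D) f i x)%E.
Proof.
move=> mD mf f0; rewrite esum_enumerated; last by move=> i; exact: integral_ge0.
under eq_integral do rewrite esum_enumerated//.
pose h n := enumerated (cst 0%E) f n.
rewrite (eq_integral (fun x => \sum_(n <oo) h n x)%E); last first.
  move=> x _; apply: eq_eseriesr => n _.
  by rewrite /h /enumerated; case: pickle_inv.
rewrite integral_nneseries//.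
- apply: eq_eseriesr => n _; rewrite /h /enumerated; case: pickle_inv => //=.
  by rewrite integral0.
- by move=> n; rewrite /h /enumerated; case: pickle_inv => //= ; exact: measurable_cst.
- by move=> n x _; rewrite /h /enumerated; case: pickle_inv => //=.
Qed.

Lemma measurable_fun_esum d (T : measurableType d) (D : set T) (f : I -> T -> \bar R) :
  (forall i, measurable_fun D (f i)) -> (forall i x, (0 <= f i x)%E) ->
  measurable_fun D (fun x => \esum_(i in [set: I]) f i x).
Proof.
move=> mf f0.
under eq_fun do rewrite esum_enumerated//.
pose h n := enumerated (cst 0%E) f n.
rewrite (_ : (fun _ => _) = (fun x => \sum_(n <oo) h n x)%E); last first.
  apply/funext => x; apply: eq_eseriesr => n _.
  by rewrite /h /enumerated; case: pickle_inv.
apply: ge0_emeasurable_sum.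
- by move=> n x _ _; rewrite /h /enumerated; case: pickle_inv => //=.
- by move=> n _; rewrite /h /enumerated; case: pickle_inv => //= ; exact: measurable_cst.
Qed.

Definition abs_summable F : Prop :=
  (\esum_(i in [set: I]) `|F i|%:E < +oo)%E.

(** As an integral against the counting measure, [rsum] inherits linearity and
    dominated convergence from the Lebesgue integral. *)
Lemma rsum_counting F :
  rsum F = \int[@counting _ R]_n enumerated 0 F n.
Proof.
rewrite /rsum /Rintegral integralE; congr (fine (_ - _)%E).
- rewrite esum_enumerated; last by move=> i; exact: funepos_ge0.
  rewrite ge0_integral_count; last by move=> i; exact: funepos_ge0.
  apply: eq_eseriesr => n _; rewrite funeposE /enumerated /=.
  by case: pickle_inv => [i|] /=; rewrite ?funeposE //= maxxx.
- rewrite esum_enumerated; last by move=> i; exact: funeneg_ge0.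
  rewrite ge0_integral_count; last by move=> i; exact: funeneg_ge0.
  apply: eq_eseriesr => n _; rewrite funenegE /enumerated /=.
  by case: pickle_inv => [i|] /=; rewrite ?funenegE //= oppr0 maxxx.
Qed.

Lemma abs_summable_counting F : abs_summable F <->
  (@counting _ R).-integrable setT (EFin \o enumerated 0 F).
Proof.
have -> : abs_summable F = (\int[@counting _ R]_n `|(enumerated 0 F n)%:E| < +oo)%E.
  rewrite ge0_integral_count // /abs_summable esum_enumerated //.
  congr (_ < _)%E; apply: eq_eseriesr => n _; rewrite /enumerated.
  by case: pickle_inv => //=; rewrite normr0.
split => [h|/integrableP[]//]; apply/integrableP; split => //.
Qed.

Lemma le_abs_summable F G : (forall i, `|F i| <= G i) -> abs_summable G -> abs_summable F.
Proof.
move=> FG; rewrite /abs_summable => hG; apply: le_lt_trans hG.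
apply: le_esum => i _; rewrite lee_fin; apply: (le_trans (FG i)); exact: ler_norm.
Qed.

Lemma abs_summableD F G : abs_summable F -> abs_summable G ->
  abs_summable (fun i => F i + G i).
Proof.
rewrite /abs_summable => hF hG.
apply: (@le_lt_trans _ _ (\esum_(i in [set: I]) (`|F i|%:E + `|G i|%:E))%E).
  by apply: le_esum => i _; rewrite -EFinD lee_fin ler_normD.
by rewrite esumD // lte_add_pinfty.
Qed.

Lemma abs_summableZ F c : abs_summable F -> abs_summable (fun i => c * F i).
Proof.
rewrite /abs_summable => hF.
under eq_esum do rewrite normrM EFinM.
rewrite esumZl // ?lee_fin //.
exact: lte_mul_pinfty.
Qed.

Lemma rsumD F G : abs_summable F -> abs_summable G ->
  rsum (fun i => F i + G i) = rsum F + rsum G.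
Proof.
move=> /abs_summable_counting hF /abs_summable_counting hG.
rewrite !rsum_counting -RintegralD //; apply: eq_Rintegral => n _.
by rewrite /enumerated; case: pickle_inv => //=; rewrite addr0.
Qed.

Lemma rsumZ F c : abs_summable F -> rsum (fun i => c * F i) = c * rsum F.
Proof.
move=> /abs_summable_counting hF.
rewrite !rsum_counting -RintegralZl //; apply: eq_Rintegral => n _.
by rewrite /enumerated; case: pickle_inv => //=; rewrite mulr0.
Qed.

Lemma ge0_rsum F : (forall i, 0 <= F i) ->
  rsum F = fine (\esum_(i in [set: I]) (F i)%:E).
Proof.
move=> F0; rewrite /rsum [X in (_ - X)%E]esum1 ?sube0.
  by congr fine; apply: eq_esum => i _; rewrite funeposE /= max_l // lee_fin.
by move=> i _; rewrite funenegE /= max_r // lee_fin oppr_le0.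
Qed.

Lemma rsum_norm_le F (G : I -> R) B : (forall i, `|F i| <= G i) ->
  (\esum_(i in [set: I]) (G i)%:E <= B%:E)%E -> `|rsum F| <= B.
Proof.
move=> FG GB.
have G0 i : 0 <= G i by apply: le_trans (FG i).
have sG : abs_summable G.
  rewrite /abs_summable; under eq_esum do rewrite ger0_norm//.
  by apply: le_lt_trans GB _; rewrite ltry.
have sF := le_abs_summable FG sG.
move: sF sG => /abs_summable_counting sF /abs_summable_counting sG.
rewrite rsum_counting; apply: le_trans (le_normr_Rintegral _ sF) _ => //.
apply: (@le_trans _ _ (rsum G)); last first.
  rewrite ge0_rsum// -lee_fin fineK//.
  rewrite ge0_fin_numE; last by apply: esum_ge0 => i _; rewrite lee_fin.
  by apply: le_lt_trans GB _; rewrite ltry.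
rewrite rsum_counting; apply: le_Rintegral => //.
- rewrite (_ : EFin \o _ = (abse \o (EFin \o enumerated 0 F))) //.
  exact: integrable_abse.
- by move=> n _; rewrite /enumerated; case: pickle_inv => //=; rewrite normr0.
Qed.

Lemma rsum_dominated (F_ : nat -> I -> R) F G :
  (forall n i, `|F_ n i| <= G i) -> abs_summable G ->
  (forall i, F_ n i @[n --> \oo] --> F i) ->
  rsum (F_ n) @[n --> \oo] --> rsum F.
Proof.
move=> FG /abs_summable_counting sG FF.
have [|||||i1 _ i3] := @dominated_convergence _ nat R (@counting _ R) setT measurableT
  (fun n k => (enumerated 0 (F_ n) k)%:E) (EFin \o enumerated 0 F) (EFin \o enumerated 0 G).
- by [].
- by [].
- apply: aeW => k _ /=; rewrite /enumerated; case: pickle_inv => /= [i|]; last exact: cvg_cst.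
  by apply: cvg_EFin; [exact: nearW|exact: FF].
- exact: sG.
- by apply: aeW => k n _ /=; rewrite lee_fin /enumerated; case: pickle_inv => //=; rewrite normr0.
have fn n : (@counting _ R).-integrable setT (EFin \o enumerated 0 (F_ n)).
  apply/abs_summable_counting; apply: le_abs_summable (FG n) _.
  exact/abs_summable_counting.
rewrite rsum_counting /Rintegral.
under eq_fun do rewrite rsum_counting /Rintegral.
apply: fine_cvg; rewrite fineK; last exact: integrable_fin_num.
exact: i3.
Qed.

Lemma rsum_eq0 F : (forall i, F i = 0) -> rsum F = 0.
Proof.
move=> F0; rewrite ge0_rsum => [|i]; last by rewrite F0.
by rewrite esum1 // => i _; rewrite F0.
Qed.

(** The involution exchanges the positive and the negative parts of [F], so that
    [rsum] subtracts a number from itself. *)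
Lemma rsum_antisym F (e : I -> I) : involutive e ->
  (forall i, F (e i) = - F i) -> rsum F = 0.
Proof.
move=> eK Fe; rewrite /rsum.
have -> : \esum_(i in [set: I]) ((EFin \o F)^\- i)%E
        = \esum_(i in [set: I]) ((EFin \o F)^\+ i)%E.
  rewrite (@reindex_esum _ _ _ setT setT e); last first.
    by rewrite setTT_bijective; exists e.
  by apply: eq_esum => i _; rewrite funenegE funeposE /= Fe opprK.
by case: (esum _ _) => //= r; rewrite subrr.
Qed.

Lemma abs_summable_sum (J : eqType) (s : seq J) (F : J -> I -> R) :
  (forall j, abs_summable (F j)) -> abs_summable (fun i => \sum_(j <- s) F j i).
Proof.
move=> h; elim: s => [|j s IH].
  rewrite /abs_summable esum1 // => i _; by rewrite big_nil normr0.
have := abs_summableD (h j) IH; congr abs_summable.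
by apply/funext => i; rewrite big_cons.
Qed.

Lemma rsum_sum (J : eqType) (s : seq J) (F : J -> I -> R) :
  (forall j, abs_summable (F j)) ->
  rsum (fun i => \sum_(j <- s) F j i) = \sum_(j <- s) rsum (F j).
Proof.
move=> h; elim: s => [|j s IH].
  by rewrite big_nil; apply: rsum_eq0 => i; rewrite big_nil.
rewrite big_cons -IH -rsumD //; last exact: abs_summable_sum.
by congr rsum; apply/funext => i; rewrite big_cons.
Qed.

(** Exchange of expectation and signed sum.  The sums [A] and [B] of the positive
    and negative parts have finite integrals, hence are finite almost everywhere,
    and there [rsum] is the genuine difference [A - B]. *)
Lemma integral_rsum d (T : measurableType d) (mu : {measure set T -> \bar R})
    (J : I -> T -> R) : (forall i, measurable_fun setT (J i)) ->
  (\esum_(i in [set: I]) \int[mu]_x `|(J i x)%:E| < +oo)%E ->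
  mu.-integrable setT (fun x => (rsum (J ^~ x))%:E) /\
  \int[mu]_x rsum (J ^~ x) = rsum (fun i => \int[mu]_x J i x).
Proof.
move=> mJ sJ.
have mJE i : measurable_fun setT (EFin \o J i) by exact/measurable_EFinP.
pose A x := \esum_(i in [set: I]) ((EFin \o J i)^\+ x)%E.
pose B x := \esum_(i in [set: I]) ((EFin \o J i)^\- x)%E.
have Jpos i x : ((EFin \o J i)^\+ x = (EFin \o J ^~ x)^\+ i)%E by rewrite !funeposE.
have Jneg i x : ((EFin \o J i)^\- x = (EFin \o J ^~ x)^\- i)%E by rewrite !funenegE.
have mpos i : measurable_fun setT ((EFin \o J i)^\+)%E by exact: measurable_funepos.
have mneg i : measurable_fun setT ((EFin \o J i)^\-)%E by exact: measurable_funeneg.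
have iA : (\int[mu]_x A x = \esum_(i in [set: I]) \int[mu]_x ((EFin \o J i)^\+ x))%E.
  by rewrite ge0_integral_esum.
have iB : (\int[mu]_x B x = \esum_(i in [set: I]) \int[mu]_x ((EFin \o J i)^\- x))%E.
  by rewrite ge0_integral_esum.
have mabs i : measurable_fun setT (fun x => `|(J i x)%:E|)%E.
  exact: (measurableT_comp (@abse_measurable R setT) (mJE i)).
have leA i : (\int[mu]_x (EFin \o J i)^\+ x <= \int[mu]_x `|(J i x)%:E|)%E.
  apply: ge0_le_integral => //.
  by move=> x _; rewrite -/((abse \o (EFin \o J i)) x) fune_abse leeDl.
have leB i : (\int[mu]_x (EFin \o J i)^\- x <= \int[mu]_x `|(J i x)%:E|)%E.
  apply: ge0_le_integral => //.
  by move=> x _; rewrite -/((abse \o (EFin \o J i)) x) fune_abse leeDr.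
have sA : (\esum_(i in [set: I]) \int[mu]_x ((EFin \o J i)^\+ x) < +oo)%E.
  by apply: le_lt_trans sJ; apply: le_esum.
have sB : (\esum_(i in [set: I]) \int[mu]_x ((EFin \o J i)^\- x) < +oo)%E.
  by apply: le_lt_trans sJ; apply: le_esum.
have intA : mu.-integrable setT A.
  apply/integrableP; split; first exact: measurable_fun_esum.
  rewrite (eq_integral A) ?iA // => x _; rewrite gee0_abs //.
  by apply: esum_ge0 => i _.
have intB : mu.-integrable setT B.
  apply/integrableP; split; first exact: measurable_fun_esum.
  rewrite (eq_integral B) ?iB // => x _; rewrite gee0_abs //.
  by apply: esum_ge0 => i _.
have FE x : rsum (J ^~ x) = fine (A x - B x)%E.
  rewrite /rsum /A /B; congr (fine (_ - _))%E; apply: eq_esum => i _; first by rewrite Jpos.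
  by rewrite Jneg.
have intAB : mu.-integrable setT (fun x => A x - B x)%E by exact: integrableB.
have aeF : ae_eq mu setT (fun x => (rsum (J ^~ x))%:E) (fun x => A x - B x)%E.
  have := integrable_ae measurableT intAB; apply: filterS => x h Tx; have {}h := h Tx.
  by rewrite FE fineK.
have mF : measurable_fun setT (fun x => (rsum (J ^~ x))%:E).
  apply/measurable_EFinP; under eq_fun do rewrite FE.
  by apply: measurableT_comp => //; exact: measurable_int intAB.
have iJ i : mu.-integrable setT (EFin \o J i).
  apply/integrableP; split => //; apply: le_lt_trans sJ.
  apply: (@le_trans _ _ (\esum_(j in [set i]) (\int[mu]_x `|(J j x)%:E|))%E).
    by rewrite esum_set1 //; exact: integral_ge0.
  rewrite esum_mkcond; apply: le_esum => j _; case: ifP => // _.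
  exact: integral_ge0.
split.
  apply/integrableP; split=> //; have /integrableP[mAB] := intAB.
  rewrite (ae_eq_integral (fun x => `|A x - B x|)%E (fun x => `|(rsum (J ^~ x))%:E|)%E) //.
  - exact: (measurableT_comp (@abse_measurable R setT) mF).
  - exact: (measurableT_comp (@abse_measurable R setT) mAB).
  - by apply: filterS aeF => x h Dx; rewrite h.
rewrite /Rintegral (ae_eq_integral _ _ measurableT mF (measurable_int mu intAB) aeF).
rewrite integralB // iA iB -esumB //; first last.
- by move=> i _; exact: integral_ge0.
- by move=> i _; exact: integral_ge0.
- rewrite /summable; apply: le_lt_trans sB; apply: le_esum => i _.
  by rewrite gee0_abs //; exact: integral_ge0.
- rewrite /summable; apply: le_lt_trans sA; apply: le_esum => i _.
  by rewrite gee0_abs //; exact: integral_ge0.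
have e : (fun i => \int[mu]_x (EFin \o J i)^\+ x - \int[mu]_x (EFin \o J i)^\- x)%E
    = EFin \o (fun i => \int[mu]_x J i x).
  apply/funext => i; rewrite /comp /Rintegral fineK; first by rewrite [RHS]integralE.
  exact: integrable_fin_num (iJ i).
by rewrite /rsum -e.
Qed.

End Sums.

(** * Finite-dimensional marginals and independence *)

Section CountableStatistics.
Context (R : realType) (disp : measure_display) (T : measurableType disp).
Context (I : countType) (theta : T -> I).
Hypothesis mtheta : forall i, measurable [set x | theta x = i].

(** A preimage under [f] is a countable union of fibers of [theta]. *)
Lemma measurable_fun_factor d' (U : measurableType d') (f : T -> U) :
  (forall x y, theta x = theta y -> f x = f y) -> measurable_fun setT f.
Proof.
move=> ff _ B mB; rewrite setTI.
pose A n := enumerated set0 (fun i => [set x | theta x = i /\ B (f x)]) n.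
rewrite (_ : _ @^-1` _ = \bigcup_n A n); last first.
  apply/seteqP; split => [x /= Bx|x [n _]]; last first.
    by rewrite /A /enumerated; case: pickle_inv => //= i [].
  by exists (pickle (theta x)) => //; rewrite /A /enumerated pickleK_inv.
apply: bigcup_measurable => n _; rewrite /A /enumerated; case: pickle_inv => //= i.
have [[y [yi By]]|nB] := pselect (exists y, theta y = i /\ B (f y)).
  rewrite (_ : [set _ | _] = [set x | theta x = i]) //.
  apply/seteqP; split => [x []//|x /= xi]; split => //.
  by rewrite (ff x y) // xi yi.
rewrite (_ : [set _ | _] = set0) //; apply/seteqP; split => // x /= h.
by apply: nB; exists x.
Qed.

(** The fibers of [theta] cut [k] into countably many pieces. *)
Lemma integral_fibers (mu : {measure set T -> \bar R}) (k : T -> R) :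
  measurable_fun setT k -> (forall x, 0 <= k x) ->
  (\int[mu]_x (k x)%:E)%E
  = \esum_(i in [set: I]) (\int[mu]_x (k x * (theta x == i)%:R)%:E)%E.
Proof.
move=> mk k0.
have mi i : measurable_fun setT (fun x => (theta x == i)%:R : R).
  by apply: measurable_fun_factor => x y ->.
rewrite -ge0_integral_esum //.
- apply: eq_integral => x _.
  rewrite (esumID [set theta x]); last by move=> i _; rewrite lee_fin mulr_ge0.
  rewrite setTI esum_set1 ?lee_fin ?mulr_ge0 //.
  rewrite eqxx mulr1 esum1 ?adde0 // => i [_ /= /eqP].
  by rewrite eq_sym => /negbTE ->; rewrite mulr0.
- move=> i; apply/measurable_EFinP; exact: measurable_funM.
- by move=> i x; rewrite lee_fin mulr_ge0.
Qed.

End CountableStatistics.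

Section FiniteMarginals.
Variables (d : nat).
Implicit Types (F G : seq (site d)) (eta zeta : config d).

Definition agree_on F eta zeta := forall x, x \in F -> eta x = zeta x.

Definition depends_on (U : Type) F (f : config d -> U) :=
  forall eta zeta, agree_on F eta zeta -> f eta = f zeta.

(** Values on [F] are recorded as a tuple because tuples of integers form a
    countable type, unlike configurations; [extend] goes back. *)
Definition restr F eta : (size F).-tuple nat := map_tuple eta (in_tuple F).

(** Outside [F] the index is [size F], which makes the value 0. *)
Definition extend F (t : (size F).-tuple nat) : config d :=
  fun x => nth 0%N t (index x F).

Lemma restr_extend F eta : agree_on F (extend (restr F eta)) eta.
Proof.
move=> x xF; rewrite /extend /= (nth_map x) ?index_mem // nth_index //.
Qed.

Lemma restr_eq F eta zeta : restr F eta = restr F zeta <-> agree_on F eta zeta.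
Proof.
split=> [h x xF|h].
  by rewrite -(restr_extend eta xF) h (restr_extend zeta xF).
by apply: val_inj => /=; apply/eq_in_map.
Qed.

Lemma extend_restr F (t : (size F).-tuple nat) : uniq F -> restr F (extend t) = t.
Proof.
move=> uF; apply: eq_from_tnth => i; rewrite tnth_map (tnth_nth 0) /=.
by rewrite /extend index_uniq // (tnth_nth 0%N).
Qed.

Lemma sub_depends_on (U : Type) F G (f : config d -> U) :
  {subset F <= G} -> depends_on F f -> depends_on G f.
Proof. by move=> FG fF e z ez; apply: fF => x /FG; exact: ez. Qed.

Lemma measurable_coordinate x n : measurable [set eta : config d | eta x = n].
Proof. by apply: sub_sigma_algebra; exists x, n. Qed.

Lemma measurable_restr F (t : (size F).-tuple nat) :
  measurable [set eta : config d | restr F eta = t].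
Proof.
have [uF|nt] := pselect (exists zeta, restr F zeta = t); last first.
  rewrite (_ : [set _ | _] = set0) //; apply/seteqP; split => // eta /= h.
  by apply: nt; exists eta.
case: uF => zeta <-.
have -> : [set eta | restr F eta = restr F zeta] = [set eta | agree_on F eta zeta].
  by apply/seteqP; split => eta /=; rewrite restr_eq.
elim: F {t} => [|x F IH].
  by rewrite (_ : [set _ | _] = setT) //; apply/seteqP; split.
rewrite (_ : [set _ | _] = [set eta | eta x = zeta x] `&` [set eta | agree_on F eta zeta]).
  by apply: measurableI => //; exact: measurable_coordinate.
apply/seteqP; split => eta /= => [h|[h1 h2] y].
  by split => [|y yF]; apply: h; rewrite inE ?eqxx ?yF ?orbT.
by rewrite inE => /orP[/eqP->|/h2].
Qed.

Lemma measurable_depends_on d' (U : measurableType d') F (f : config d -> U) :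
  depends_on F f -> measurable_fun setT f.
Proof.
move=> fF; apply: (measurable_fun_factor (theta := restr F)) => [t|x y /restr_eq].
  exact: measurable_restr.
exact: fF.
Qed.

End FiniteMarginals.

Section ProductLaw.
Variables (R : realType) (d : nat) (P : probability (config d) R).
Hypotheses (hprod : product_measure P) (htrans : translation_invariant_measure P).
Local Notation mu := (marginal P).
Implicit Types (F G : seq (site d)).

Lemma marginalE x n : fine (P [set eta | eta x = n]) = mu n.
Proof.
rewrite /marginal /pushforward; congr fine.
have := htrans x (measurable_coordinate (0 : site d) n).
by rewrite /= add0r.
Qed.

Arguments marginalE x n : clear implicits.

Lemma marginal_ge0 n : 0 <= mu n.
Proof. by rewrite -(marginalE 0 n) fine_ge0. Qed.

Lemma prob_restr F (t : (size F).-tuple nat) : uniq F ->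
  P [set eta | restr F eta = t] = (\prod_(x <- F) mu (extend t x))%:E.
Proof.
move=> uF.
rewrite -[LHS]fineK; last by apply: fin_num_measure; exact: measurable_restr.
congr EFin.
under eq_bigr => x _ do rewrite -(marginalE x).
have := hprod (fun x => [set extend t x]) uF.
rewrite /= => <-; congr (fine (P _)); apply/seteqP; split => eta /=.
  by move=> <- x xF; rewrite restr_extend.
by move=> h; rewrite -[RHS](extend_restr _ uF); apply/restr_eq.
Qed.

(** On each fiber of [restr F] the function [f] is constant and leaves the
    integral. *)
Lemma integral_restr F (k f : config d -> R) : uniq F -> depends_on F f ->
  measurable_fun setT k -> (forall eta, 0 <= k eta) -> (forall eta, 0 <= f eta) ->
  (\int[P]_eta (k eta * f eta)%:E)%E =
  \esum_(t in [set: (size F).-tuple nat])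
     ((f (extend t))%:E * \int[P]_eta (k eta * (restr F eta == t)%:R)%:E)%E.
Proof.
move=> uF fF mk k0 f0.
rewrite (integral_fibers (theta := restr F)); first last.
- by move=> eta; rewrite mulr_ge0.
- apply: measurable_funM => //; exact: measurable_depends_on fF.
- exact: measurable_restr.
apply: eq_esum => t _.
rewrite -ge0_integralZl_EFin //; last 2 first.
- by move=> x _; rewrite lee_fin mulr_ge0.
- apply/measurable_EFinP; apply: measurable_funM => //.
  by apply: (@measurable_depends_on _ _ _ F) => x y /restr_eq ->.
apply: eq_integral => eta _; rewrite -EFinM; congr EFin.
have [e|_] := eqVneq (restr F eta) t; last by rewrite !mulr0.
rewrite !mulr1 mulrC -e; congr (_ * _); apply: fF => x xF.
by rewrite restr_extend.
Qed.

Lemma indicator_integral (A : set (config d)) (b : config d -> bool) : measurable A ->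
  (forall eta, A eta <-> b eta) ->
  (\int[P]_eta ((b eta)%:R)%:E)%E = P A.
Proof.
move=> mA Ab; rewrite -[in RHS](setIT A) -integral_indic //; apply: eq_integral => eta _.
rewrite indicE; congr (_%:R%:E); congr nat_of_bool.
by apply/idP/idP; rewrite inE => /Ab.
Qed.

(** The product formula for cylinder events, applied to the concatenated sites. *)
Lemma prob_restr2 F G t s : uniq (F ++ G) ->
  P ([set eta | restr F eta = t] `&` [set eta | restr G eta = s])
  = (P [set eta | restr F eta = t] * P [set eta | restr G eta = s])%E.
Proof.
move=> uFG; have := uFG; rewrite cat_uniq => /and3P[uF /hasPn dFG uG].
rewrite !prob_restr // -EFinM.
rewrite -[LHS]fineK; last first.
  by apply: fin_num_measure; apply: measurableI; exact: measurable_restr.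
congr EFin.
pose z x := if x \in F then extend t x else extend s x.
have := hprod (fun x => [set z x]) uFG.
have -> : [set eta : config d | forall x, x \in F ++ G -> [set z x] (eta x)]
   = [set eta | restr F eta = t] `&` [set eta | restr G eta = s].
  apply/seteqP; split => eta /= => [h|[h1 h2] x].
    split; [rewrite -[RHS](extend_restr _ uF)|rewrite -[RHS](extend_restr _ uG)];
      apply/restr_eq => x xF; rewrite h ?mem_cat ?xF ?orbT // /z ?xF //.
    by rewrite ifN // dFG.
  rewrite mem_cat /z; case: ifP => [xF _|xF /= xG].
    by rewrite -h1 restr_extend.
  by rewrite -h2 restr_extend.
move=> ->; rewrite big_cat /=; congr (_ * _); apply: eq_big_seq => x xF.
  by rewrite marginalE /z xF.
by rewrite marginalE /z ifN // dFG.
Qed.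

(** Expanding both functions over the values of their coordinates reduces
    independence to that of cylinder events ([prob_restr2]). *)
Lemma integral_independent F G (f h : config d -> R) : uniq (F ++ G) ->
  depends_on F f -> depends_on G h ->
  (forall eta, 0 <= f eta) -> (forall eta, 0 <= h eta) ->
  (\int[P]_eta (h eta)%:E < +oo)%E ->
  (\int[P]_eta (f eta * h eta)%:E
   = \int[P]_eta (f eta)%:E * \int[P]_eta (h eta)%:E)%E.
Proof.
move=> uFG fF hG f0 h0 hfin; have := uFG; rewrite cat_uniq => /and3P[uF _ uG].
have mh := measurable_depends_on hG.
have mf := measurable_depends_on fF.
have step t : (\int[P]_eta (h eta * (restr F eta == t)%:R)%:E
   = P [set eta | restr F eta = t] * \int[P]_eta (h eta)%:E)%E.
  under eq_integral do rewrite mulrC.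
  rewrite (integral_restr uG hG) //; last first.
    by apply: (@measurable_depends_on _ _ _ F) => x y /restr_eq ->.
  rewrite [X in (_ = _ * X)%E](_ : _ = \int[P]_eta (1 * h eta)%:E)%E; last first.
    by apply: eq_integral => eta _; rewrite mul1r.
  rewrite (integral_restr uG hG) // prob_restr // -esumZl; last 2 first.
  - by move=> s; apply: mule_ge0; rewrite ?lee_fin //; apply: integral_ge0 => eta _;
    rewrite lee_fin mulr_ge0.
  - by apply: prodr_ge0 => x _; exact: marginal_ge0.
  apply: eq_esum => s _; rewrite muleCA; congr (_ * _)%E.
  rewrite -(prob_restr _ uF).
  rewrite [X in (_ = _ * X)%E](_ : _ = \int[P]_eta (restr G eta == s)%:R%:E)%E; last first.
    by apply: eq_integral => eta _; rewrite mul1r.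
  rewrite (@indicator_integral [set eta | restr G eta = s]); last 2 first.
  - exact: measurable_restr.
  - by move=> eta /=; split => /eqP.
  rewrite -prob_restr2 //.
  rewrite -(@indicator_integral _ (fun eta => (restr F eta == t) && (restr G eta == s))).
  - by apply: eq_integral => eta _; rewrite -natrM mulnb.
  - by apply: measurableI; exact: measurable_restr.
  - by move=> eta /=; split => [[-> ->]|/andP[/eqP -> /eqP ->]]; rewrite ?eqxx.
under eq_integral do rewrite mulrC.
rewrite (integral_restr uF fF) //.
rewrite [X in (_ = X * _)%E](_ : _ = \int[P]_eta (1 * f eta)%:E)%E; last first.
  by apply: eq_integral => eta _; rewrite mul1r.
rewrite (integral_restr uF fF) //.
have : (0 <= \int[P]_eta (h eta)%:E)%E by apply: integral_ge0 => eta _; rewrite lee_fin.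
move: hfin step; case: (\int[P]_eta (h eta)%:E)%E => // c _ step c0.
rewrite muleC -esumZl //; last first.
  by move=> t; apply: mule_ge0; rewrite ?lee_fin //; apply: integral_ge0 => eta _;
    rewrite lee_fin mulr_ge0.
apply: eq_esum => t _; rewrite step [RHS]muleCA; congr (_ * _)%E.
rewrite muleC; congr (_ * _)%E.
rewrite -(@indicator_integral [set eta | restr F eta = t] (fun eta => restr F eta == t)).
- by apply: eq_integral => eta _; rewrite mul1r.
- exact: measurable_restr.
- by move=> eta /=; split => /eqP.
Qed.

End ProductLaw.

(** * Jumps between two sites under a product law *)

Section PairSums.
Variable R : realType.
Local Open Scope ereal_scope.

Lemma esum_shiftl (H : nat -> nat -> \bar R) :
  (forall a b, 0 <= H a b) -> (forall b, H 0%N b = 0) ->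
  \esum_(ab in [set: nat * nat]) H ab.1 ab.2
  = \esum_(ab in [set: nat * nat]) H ab.1.+1 ab.2.
Proof.
move=> H0 Hz; rewrite (esumID [set ab | (0 < ab.1)%N]) //.
rewrite [X in _ + X]esum1 ?adde0; last by move=> [[|a] b] [_ h]; rewrite ?Hz //; case: h.
rewrite setTI (@reindex_esum _ _ _ setT _ (fun ab => (ab.1.+1, ab.2))) //.
split => //.
- by move=> [a b] [a' b'] _ _ /= [-> ->].
- by move=> [[|a] b] //= _; exists (a, b).
Qed.

Lemma esum_shiftr (H : nat -> nat -> \bar R) :
  (forall a b, 0 <= H a b) -> (forall a, H a 0%N = 0) ->
  \esum_(ab in [set: nat * nat]) H ab.1 ab.2
  = \esum_(ab in [set: nat * nat]) H ab.1 ab.2.+1.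
Proof.
move=> H0 Hz; rewrite (esumID [set ab | (0 < ab.2)%N]) //.
rewrite [X in _ + X]esum1 ?adde0; last by move=> [a [|b]] [_ h]; rewrite ?Hz //; case: h.
rewrite setTI (@reindex_esum _ _ _ setT _ (fun ab => (ab.1, ab.2.+1))) //.
split => //.
- by move=> [a b] [a' b'] _ _ /= [-> ->].
- by move=> [a [|b]] //= _; exists (a, b).
Qed.

Lemma esum_pair (I J : choiceType) (F : I -> J -> \bar R) :
  (forall i j, 0 <= F i j) ->
  \esum_(ij in [set: I * J]) F ij.1 ij.2 = \esum_(i in [set: I]) \esum_(j in [set: J]) F i j.
Proof.
move=> F0; rewrite esum_esum //; congr esum.
by apply/seteqP; split.
Qed.

Lemma esum_single (I : choiceType) (i : I) (F : I -> \bar R) :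
  (forall j, 0 <= F j) -> (forall j, j != i -> F j = 0) ->
  \esum_(j in [set: I]) F j = F i.
Proof.
move=> F0 Fi; rewrite (esumID [set i]) // setTI esum_set1 // esum1 ?adde0 //.
by move=> j [_ /= /eqP]; exact: Fi.
Qed.

End PairSums.

Section TwoSites.
Variables (R : realType) (d : nat) (P : probability (config d) R).
Hypotheses (hprod : product_measure P) (htrans : translation_invariant_measure P).
Local Notation mu := (marginal P).
Implicit Types (F : seq (site d)) (x y : site d).

Lemma integral_probability_cst (c : R) : (\int[P]_eta c%:E = c%:E)%E.
Proof.
rewrite integral_cst // (_ : _ [set: _] = 1%E) ?mule1 //.
exact: probability_setT.
Qed.

(** Freezing the occupation numbers at [x] and [y]. *)
Definition put x y a b (eta : config d) : config d :=
  fun z => if z == x then a else if z == y then b else eta z.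

Lemma prob_pair x y (a b : nat) : x != y ->
  P [set eta | (eta x, eta y) = (a, b)] = (mu a * mu b)%:E.
Proof.
move=> xy; have u : uniq [:: x; y] by rewrite /= inE xy.
pose t : (size [:: x; y]).-tuple nat := [tuple a; b].
have tx : extend t x = a by rewrite /extend /= eqxx.
have ty : extend t y = b by rewrite /extend /= (negbTE xy) eqxx.
have := prob_restr hprod htrans t u.
rewrite !big_cons big_nil mulr1 tx ty => <-.
congr (P _); apply/seteqP; split => eta /=.
  by move=> [ex ey]; apply: val_inj; rewrite /= ex ey.
by move=> /(congr1 val) /= [-> ->].
Qed.

(** Conditioning on the occupation numbers at [x] and [y]: what remains of [f] is
    a function of the other sites, independent of them. *)
Lemma integral_two_sites x y F (phi : nat -> nat -> R) (f : config d -> R) B :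
  uniq [:: x, y & F] -> depends_on [:: x, y & F] f ->
  (forall a b, 0 <= phi a b) -> (forall eta, 0 <= f eta <= B) ->
  (\int[P]_eta (phi (eta x) (eta y) * f eta)%:E)%E =
  \esum_(ab in [set: nat * nat]) ((phi ab.1 ab.2 * (mu ab.1 * mu ab.2))%:E
     * \int[P]_eta (f (put x y ab.1 ab.2 eta))%:E)%E.
Proof.
move=> uF fF phi0 fB.
have /and3P[xyF yF uF'] := uF.
have xy : x != y by move: xyF; rewrite inE negb_or => /andP[].
pose theta (eta : config d) := (eta x, eta y).
have mtheta ab : measurable [set eta | theta eta = ab].
  case: ab => a b; rewrite (_ : [set _ | _] = [set eta | eta x = a] `&` [set eta | eta y = b]).
    by apply: measurableI; exact: measurable_coordinate.
  by apply/seteqP; split => eta; rewrite /theta /= => -[-> ->].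
have dphi : depends_on [:: x; y] (fun eta => phi (eta x) (eta y)).
  by move=> e z ez; rewrite !ez // !inE eqxx ?orbT.
rewrite (integral_fibers mtheta); first last.
- by move=> eta; rewrite mulr_ge0 // (andP (fB _)).1.
- apply: measurable_funM; first exact: measurable_depends_on dphi.
  exact: measurable_depends_on fF.
apply: eq_esum => -[a b] _ /=.
have dput : depends_on F (fun eta => f (put x y a b eta)).
  move=> e z ez; apply: fF => v; rewrite /put !inE.
  by case: eqP => // _; case: eqP => //= _; exact: ez.
have dind : depends_on [:: x; y] (fun eta => phi a b * (theta eta == (a, b))%:R).
  by move=> e z ez; rewrite /theta !ez // !inE eqxx ?orbT.
transitivity (\int[P]_eta ((phi a b * (theta eta == (a, b))%:R) * f (put x y a b eta))%:E)%E.
  apply: eq_integral => eta _; congr EFin; rewrite /theta.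
  case: eqP => [[ea eb]|_]; last by rewrite !(mulr0, mul0r).
  rewrite !mulr1 ea eb; congr (_ * f _); apply/funext => v.
  by rewrite /put; case: eqP => [->|_] //; case: eqP => [->|_].
have fin : (\int[P]_eta (f (put x y a b eta))%:E < +oo)%E.
  apply: (@le_lt_trans _ _ (\int[P]_eta B%:E)%E).
    apply: ge0_le_integral => //.
    - by move=> eta _; rewrite lee_fin (andP (fB _)).1.
    - by apply/measurable_EFinP; exact: measurable_depends_on dput.
    - by move=> eta _; rewrite lee_fin (andP (fB _)).2.
  by rewrite integral_probability_cst ltry.
rewrite (@integral_independent _ _ _ hprod htrans [:: x; y] F) //.
- congr (_ * _)%E; under eq_integral do rewrite EFinM.
  rewrite ge0_integralZl_EFin //; last first.
    by apply/measurable_EFinP; apply: (measurable_fun_factor mtheta) => u v ->.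
  rewrite (@indicator_integral _ _ _ [set eta | theta eta = (a, b)]) //.
  + by rewrite prob_pair // -EFinM.
  + by move=> eta /=; split => /eqP.
- by move=> eta; rewrite mulr_ge0.
- by move=> eta; rewrite (andP (fB _)).1.
Qed.

Lemma integral_pair x y (phi : nat -> nat -> R) : x != y ->
  (forall a b, 0 <= phi a b) ->
  (\int[P]_eta (phi (eta x) (eta y))%:E)%E =
  \esum_(ab in [set: nat * nat]) (phi ab.1 ab.2 * (mu ab.1 * mu ab.2))%:E.
Proof.
move=> xy phi0.
have := @integral_two_sites x y [::] phi (fun=> 1) 1.
rewrite /= inE xy => /(_ isT).
under eq_integral do rewrite mulr1.
move=> -> //; last by move=> _; rewrite ler01 lexx.
by apply: eq_esum => ab _; rewrite integral_probability_cst mule1.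
Qed.

Lemma migrate_put x y a b eta : x != y ->
  migrate 1 x y (put x y a.+1 b eta) = put x y a b.+1 eta.
Proof.
move=> xy; have yx : (y == x) = false by rewrite eq_sym (negbTE xy).
rewrite /migrate xy /put eqxx /=; apply/funext => z.
by case: (z == x); rewrite ?subn1 // yx eqxx addn1; case: (z == y).
Qed.

Lemma depends_on_migrate x y F (f : config d -> R) :
  depends_on F f -> depends_on [:: x, y & F] (fun eta => f (migrate 1 x y eta)).
Proof.
move=> fF e z ez; apply: fF => v vF.
have ex : e x = z x by apply: ez; rewrite !inE eqxx.
have ey : e y = z y by apply: ez; rewrite !inE eqxx orbT.
have ev : e v = z v by apply: ez; rewrite !inE vF !orbT.
by rewrite /migrate ex ey; case: ifP; rewrite ?ev.
Qed.

(** A jump from [x] to [y] leads from the occupation numbers (a+1, b) to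
    (a, b+1), and by hypothesis it has there the weight of the reverse jump.
    Expanding both sides over the two occupation numbers matches them term by
    term, once the vanishing terms (no particle to move) are shifted out. *)
Lemma integral_reversal x y F (q : nat -> nat -> R) (f : config d -> R) B :
  x != y -> depends_on F f -> (forall eta, 0 <= f eta <= B) ->
  (forall a b, 0 <= q a b) -> (forall b, q 0%N b = 0) ->
  (forall a b, q a.+1 b * (mu a.+1 * mu b) = q b.+1 a * (mu b.+1 * mu a)) ->
  (\int[P]_eta (q (eta x) (eta y) * f (migrate 1 x y eta))%:E
   = \int[P]_eta (q (eta y) (eta x) * f eta)%:E)%E.
Proof.
move=> xy fF fB q0 qz qrev.
pose G := [seq z <- undup F | (z != x) && (z != y)].
have uG : uniq [:: x, y & G].
  by rewrite /= !inE (negbTE xy) !mem_filter !eqxx /= andbF /= filter_uniq // undup_uniq.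
have FG : {subset F <= [:: x, y & G]}.
  move=> z zF; rewrite !inE mem_filter mem_undup zF andbT.
  by case: (z == x) (z == y) => [] [].
have fG : depends_on [:: x, y & G] f by exact: sub_depends_on fF.
have fG' : depends_on [:: x, y & G] (fun eta => f (migrate 1 x y eta)).
  apply: (sub_depends_on _ (@depends_on_migrate x y _ _ fF)) => z.
  by rewrite !(in_cons x) !(in_cons y) => /or3P[->|->|/FG] //; rewrite ?orbT // !inE.
rewrite (integral_two_sites (B := B) uG fG') //.
rewrite (integral_two_sites (phi := fun a b => q b a) (B := B) uG fG) //.
have I0 (h : config d -> R) : (forall e, 0 <= h e) -> (0 <= \int[P]_eta (h eta)%:E)%E.
  by move=> h0; apply: integral_ge0 => e _; rewrite lee_fin.
have f0 eta : 0 <= f eta by case/andP: (fB eta).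
have mu0 := marginal_ge0 htrans.
rewrite (esum_shiftl (H := fun a b => (q a b * (mu a * mu b))%:E
   * \int[P]_eta (f (migrate 1 x y (put x y a b eta)))%:E)%E); last 2 first.
- by move=> a b; apply: mule_ge0; [rewrite lee_fin !mulr_ge0|exact: I0].
- by move=> b; rewrite qz !mul0r mul0e.
rewrite (esum_shiftr (H := fun a b => (q b a * (mu a * mu b))%:E
   * \int[P]_eta (f (put x y a b eta))%:E)%E); last 2 first.
- by move=> a b; apply: mule_ge0; [rewrite lee_fin !mulr_ge0|exact: I0].
- by move=> a; rewrite qz !mul0r mul0e.
apply: eq_esum => -[a b] _ /=; congr (_ * _)%E.
  by rewrite qrev [mu b.+1 * _]mulrC.
by apply: eq_integral => eta _; rewrite migrate_put.
Qed.

End TwoSites.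

(** * Mean of the generator on cylinder functions *)

Section KernelSums.
Variables (R : realType) (d : nat) (p : site d -> site d -> R).
Hypothesis hp : transition_kernel p.

(** By translation invariance a column of [p] is a rearranged row. *)
Lemma esum_kernel_col (v : site d) : \esum_(x in [set: site d]) (p x v)%:E = 1%E.
Proof.
rewrite -(tk_sum1 hp 0).
have bij : set_bij [set: site d] [set: site d] (fun x : site d => v - x).
  by rewrite setTT_bijective; exists (fun x => v - x) => x; rewrite subKr.
rewrite [RHS](@reindex_esum _ _ _ _ _ _ _ bij); apply: eq_esum => x _; congr EFin.
by have := tk_translation hp 0 (v - x) x; rewrite add0r subrK.
Qed.

Lemma esum_departures (v : site d) :
  \esum_(xy in [set: site d * site d]) (p xy.1 xy.2 * (xy.1 == v)%:R)%:E = 1%E.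
Proof.
rewrite (esum_pair (F := fun x y => (p x y * (x == v)%:R)%:E)); last first.
  by move=> x y; rewrite lee_fin mulr_ge0 // tk_ge0.
rewrite (esum_single (i := v)).
- by rewrite -(tk_sum1 hp v); apply: eq_esum => y _; rewrite eqxx mulr1.
- by move=> x; apply: esum_ge0 => y _; rewrite lee_fin mulr_ge0 // (tk_ge0 hp).
- by move=> x /negbTE xv; apply: esum1 => y _; rewrite xv mulr0.
Qed.

Lemma esum_arrivals (v : site d) :
  \esum_(xy in [set: site d * site d]) (p xy.1 xy.2 * (xy.2 == v)%:R)%:E = 1%E.
Proof.
rewrite (esum_pair (F := fun x y => (p x y * (y == v)%:R)%:E)); last first.
  by move=> x y; rewrite lee_fin mulr_ge0 // tk_ge0.
rewrite -(esum_kernel_col v); apply: eq_esum => x _.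
rewrite (esum_single (i := v)) ?eqxx ?mulr1 //.
- by move=> y; rewrite lee_fin mulr_ge0 // (tk_ge0 hp).
- by move=> y /negbTE xv; rewrite xv mulr0.
Qed.

Lemma abs_summable_departures v :
  abs_summable (fun xy : site d * site d => p xy.1 xy.2 * (xy.1 == v)%:R).
Proof.
rewrite /abs_summable; under eq_esum do rewrite ger0_norm ?mulr_ge0 ?(tk_ge0 hp)//.
by rewrite esum_departures ltry.
Qed.

Lemma abs_summable_arrivals v :
  abs_summable (fun xy : site d * site d => p xy.1 xy.2 * (xy.2 == v)%:R).
Proof.
rewrite /abs_summable; under eq_esum do rewrite ger0_norm ?mulr_ge0 ?(tk_ge0 hp)//.
by rewrite esum_arrivals ltry.
Qed.

Lemma rsum_departures v :
  rsum (fun xy : site d * site d => p xy.1 xy.2 * (xy.1 == v)%:R) = 1.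
Proof.
rewrite ge0_rsum ?esum_departures // => xy.
by rewrite mulr_ge0 // (tk_ge0 hp).
Qed.

Lemma rsum_arrivals v :
  rsum (fun xy : site d * site d => p xy.1 xy.2 * (xy.2 == v)%:R) = 1.
Proof.
rewrite ge0_rsum ?esum_arrivals // => xy.
by rewrite mulr_ge0 // (tk_ge0 hp).
Qed.

(** Only jumps with an endpoint in [F] change a function of the sites in [F]; this
    summable family dominates their contributions. *)
Lemma abs_summable_touching (F : seq (site d)) (c : R) :
  abs_summable (fun xy : site d * site d => \sum_(v <- F)
    c * (p xy.1 xy.2 * (xy.1 == v)%:R + p xy.1 xy.2 * (xy.2 == v)%:R)).
Proof.
apply: abs_summable_sum => v; apply: abs_summableZ.
by apply: abs_summableD; [exact: abs_summable_departures|exact: abs_summable_arrivals].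
Qed.

(** Rows and columns of [p] both sum to 1, so the mass [phi] carried along the
    jumps enters and leaves in equal total amounts. *)
Lemma rsum_transport (F : seq (site d)) (phi : site d -> R) : uniq F ->
  (forall x, x \notin F -> phi x = 0) ->
  rsum (fun xy : site d * site d => p xy.1 xy.2 * (phi xy.2 - phi xy.1)) = 0.
Proof.
move=> uF phiF.
have phiE x : phi x = \sum_(v <- F) phi v * (x == v)%:R.
  have [xF|xF] := boolP (x \in F).
    rewrite (bigD1_seq x) //= eqxx mulr1 big1 ?addr0 // => v vx.
    by rewrite eq_sym (negbTE vx) mulr0.
  rewrite phiF // big_seq big1 // => v vF.
  by case: eqP => [xv|_]; [rewrite -xv (negbTE xF) in vF|rewrite mulr0].
transitivity (rsum (fun xy : site d * site d => \sum_(v <- F)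
   phi v * (p xy.1 xy.2 * (xy.2 == v)%:R + -1 * (p xy.1 xy.2 * (xy.1 == v)%:R)))).
  congr rsum; apply/funext => -[x y] /=.
  rewrite [phi y]phiE [phi x]phiE -sumrB big_distrr /=.
  by apply: eq_bigr => v _; ring.
have sD v := abs_summable_departures v.
have sA v := abs_summable_arrivals v.
have sN v := abs_summableZ (-1) (sD v).
rewrite rsum_sum => [|v]; last by apply/abs_summableZ/abs_summableD.
rewrite big1 // => v _.
rewrite rsumZ; last exact: abs_summableD.
by rewrite rsumD // rsumZ // rsum_arrivals rsum_departures mulr1 subrr mulr0.
Qed.

End KernelSums.

Section MeanGenerator.
Variables (R : realType) (d : nat) (p : site d -> site d -> R).
Hypothesis hp : transition_kernel p.
Variable g : nat -> nat -> nat -> R.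
Hypotheses (hg : mmp_rates g) (hMP : single_jump g).
Variable (P : probability (config d) R).
Implicit Types (F : seq (site d)) (x y : site d) (f : config d -> R) (eta : config d).
Local Notation q eta x y := (g 1 (eta x) (eta y)).

Lemma generator_single_jump f eta :
  generator p g f eta = rsum (fun xy : site d * site d =>
    p xy.1 xy.2 * q eta xy.1 xy.2 * (f (migrate 1 xy.1 xy.2 eta) - f eta)).
Proof.
congr rsum; apply/funext => -[x y] /=.
case: (eta x) => [|n]; first by rewrite big_geq // rates_empty // mulr0 mul0r.
rewrite big_nat_recl // big_nat big1 ?addr0 // => k /andP[k1 _].
by rewrite hMP // mulr0 mul0r.
Qed.

Lemma migrate_id x eta : migrate 1 x x eta = eta.
Proof. by rewrite /migrate eqxx andbF. Qed.

Lemma migrate_agree F x y eta : x \notin F -> y \notin F ->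
  agree_on F (migrate 1 x y eta) eta.
Proof.
move=> xF yF z zF; rewrite /migrate; case: ifP => // _.
case: eqP => [zx|_]; first by rewrite -zx zF in xF.
by case: eqP => [zy|_] //; rewrite -zy zF in yF.
Qed.

(** The contribution of jumps from [xy.1] to [xy.2] to the mean of the
    generator. *)
Definition mean_flux f (xy : site d * site d) : R :=
  p xy.1 xy.2 * \int[P]_eta (q eta xy.1 xy.2 * (f (migrate 1 xy.1 xy.2 eta) - f eta)).

Lemma mean_flux_diag f x : mean_flux f (x, x) = 0.
Proof.
rewrite /mean_flux /= /Rintegral integral0_eq ?mulr0 // => eta _.
by rewrite migrate_id subrr mulr0.
Qed.

Variable K : R.
Hypothesis hK : forall x y, x != y -> (\int[P]_eta (q eta x y)%:E <= K%:E)%E.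

Lemma K_ge0 x y : x != y -> 0 <= K.
Proof.
move=> xy; rewrite -lee_fin; apply: le_trans (hK xy).
by apply: integral_ge0 => eta _; rewrite lee_fin rates_ge0.
Qed.

Lemma measurable_rate x y : measurable_fun setT (fun eta : config d => q eta x y).
Proof.
apply: (@measurable_depends_on _ _ _ [:: x; y]) => e z ez.
by rewrite !ez // !inE eqxx ?orbT.
Qed.

Lemma integrable_rate x y (h : config d -> R) B : x != y -> measurable_fun setT h ->
  (forall eta, `|h eta| <= B) ->
  P.-integrable setT (fun eta => (q eta x y * h eta)%:E).
Proof.
move=> xy mh hB.
have mq := measurable_rate x y.
apply: (@le_integrable _ _ _ P _ _ _ (fun eta => (B * q eta x y)%:E)) => //.
- by apply/measurable_EFinP; exact: measurable_funM.
- move=> eta _; rewrite /= lee_fin normrM mulrC; apply: le_trans (ler_norm _).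
  by rewrite [`|g _ _ _|]ger0_norm ?rates_ge0 // ler_wpM2r // rates_ge0.
have : P.-integrable setT (fun eta => (q eta x y)%:E); last first.
  exact: integrableZl.
apply/integrableP; split; first exact/measurable_EFinP.
under eq_integral do rewrite gee0_abs ?lee_fin ?rates_ge0//.
exact: (le_lt_trans (hK xy)) (ltry _).
Qed.

Section CylinderFunction.
Variables (F : seq (site d)) (f : config d -> R) (B : R).
Hypotheses (fF : depends_on F f) (fB : forall eta, `|f eta| <= B).

Let jump (xy : site d * site d) eta : R :=
  p xy.1 xy.2 * q eta xy.1 xy.2 * (f (migrate 1 xy.1 xy.2 eta) - f eta).

Lemma measurable_jump xy : measurable_fun setT (jump xy).
Proof.
case: xy => x y.
apply: (@measurable_depends_on _ _ _ [:: x, y & F]) => e z ez.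
rewrite /jump /=; have -> : e x = z x by apply: ez; rewrite !inE eqxx.
have -> : e y = z y by apply: ez; rewrite !inE eqxx orbT.
rewrite (depends_on_migrate fF ez) (fF (eta := e) (zeta := z)) // => v vF.
by apply: ez; rewrite !inE vF !orbT.
Qed.

(** Jumps with both ends outside [F] leave [f] unchanged; the others move it by at
    most 2 B, at mean rate at most K p(x, y). *)
Lemma jump_bound x y : x != y ->
  (\int[P]_eta `|(jump (x, y) eta)%:E|
   <= (\sum_(v <- F) (2 * B * K) * (p x y * (x == v)%:R + p x y * (y == v)%:R))%:E)%E.
Proof.
move=> xy; have K0 := K_ge0 xy.
have B0 : 0 <= B by apply: le_trans (fB (fun=> 0%N)).
have t0 v : 0 <= 2 * B * K * (p x y * (x == v)%:R + p x y * (y == v)%:R).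
  by rewrite !mulr_ge0 // addr_ge0 // mulr_ge0 // (tk_ge0 hp).
have [xyF|] := boolP ((x \in F) || (y \in F)); last first.
  rewrite negb_or => /andP[xF yF].
  rewrite (eq_integral (cst 0%E)) ?integral_cst ?mul0e // => [|eta _].
    by rewrite lee_fin; apply: sumr_ge0 => v _.
  by rewrite /jump /= (fF (migrate_agree eta xF yF)) subrr mulr0 normr0.
apply: (@le_trans _ _ (\int[P]_eta (2 * B * p x y * q eta x y)%:E)%E).
  apply: ge0_le_integral => //.
  - apply/measurable_EFinP/measurableT_comp => //; exact: measurable_jump.
  - apply/measurable_EFinP/measurable_funM => //; exact: measurable_rate.
  - move=> eta _; rewrite /jump /= lee_fin normrM ger0_norm; last first.
      by rewrite mulr_ge0 ?(tk_ge0 hp) ?rates_ge0.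
    rewrite [leRHS](_ : _ = p x y * q eta x y * (B + B)); last by ring.
    apply: ler_wpM2l; first by rewrite mulr_ge0 ?(tk_ge0 hp) ?rates_ge0.
    by apply: le_trans (ler_normB _ _) _; apply: lerD.
under eq_integral do rewrite EFinM.
rewrite ge0_integralZl_EFin //; last 3 first.
- by move=> eta _; rewrite lee_fin rates_ge0.
- by apply/measurable_EFinP; exact: measurable_rate.
- by rewrite !mulr_ge0 // (tk_ge0 hp).
apply: (@le_trans _ _ ((2 * B * p x y)%:E * K%:E)%E).
  by apply: lee_wpmul2l; [rewrite lee_fin !mulr_ge0 // (tk_ge0 hp)|exact: hK].
rewrite -EFinM lee_fin.
have [v vF hv] : exists2 v, v \in F & (1 : R) <= (x == v)%:R + (y == v)%:R.
  case/orP: xyF => [xF|yF]; [exists x|exists y] => //; rewrite eqxx.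
    by rewrite lerDl.
  by rewrite lerDr.
rewrite (big_rem v) //=; apply: ler_wpDr; first by apply: sumr_ge0.
rewrite -mulrDr [leLHS](_ : _ = 2 * B * K * (p x y * 1)); last by ring.
by rewrite !ler_wpM2l // ?mulr_ge0 // (tk_ge0 hp).
Qed.

Lemma sum_jump_fin :
  (\esum_(xy in [set: site d * site d]) \int[P]_eta `|(jump xy eta)%:E| < +oo)%E.
Proof.
have [K0|K0] := leP 0 K; last first.
  rewrite esum1 ?ltry // => -[x y] _; have [<-|xy] := eqVneq x y; last first.
    by have := K_ge0 xy; rewrite leNgt K0.
  rewrite (eq_integral (cst 0%E)) ?integral_cst ?mul0e // => eta _.
  by rewrite /jump /= migrate_id subrr mulr0 normr0.
apply: le_lt_trans (abs_summable_touching hp F (2 * B * K)).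
apply: le_esum => -[x y] _ /=.
have [<-|xy] := eqVneq x y; last first.
  by apply: le_trans (jump_bound xy) _; rewrite lee_fin ler_norm.
rewrite (eq_integral (cst 0%E)) ?integral_cst ?mul0e ?lee_fin // => eta _.
by rewrite /jump /= migrate_id subrr mulr0 normr0.
Qed.

Let integral_jump xy : \int[P]_eta jump xy eta = mean_flux f xy.
Proof.
case: xy => x y; rewrite /mean_flux /=.
have [<-|xy] := eqVneq x y.
  have Z (h : config d -> R) : (forall eta, h eta = 0) -> \int[P]_eta h eta = 0.
    by move=> h0; rewrite /Rintegral integral0_eq // => eta _; rewrite h0.
  rewrite !Z ?mulr0 // => eta; first by rewrite migrate_id subrr mulr0.
  by rewrite /jump /= migrate_id subrr mulr0.
rewrite -RintegralZl //.
  by apply: eq_Rintegral => eta _; rewrite /jump /= mulrA.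
apply: (@integrable_rate x y (fun eta => f (migrate 1 x y eta) - f eta) (B + B)) => //.
  apply: measurable_funB; last exact: measurable_depends_on fF.
  exact: measurable_depends_on (@depends_on_migrate _ _ x y _ _ fF).
by move=> eta; apply: le_trans (ler_normB _ _) _; apply: lerD.
Qed.

(** The bound [jump_bound] is summable over the jumps, which allows the exchange
    of the expectation with the sum defining the generator. *)
Lemma integral_generator :
  P.-integrable setT (fun eta => (generator p g f eta)%:E) /\
  \int[P]_eta generator p g f eta = rsum (mean_flux f).
Proof.
have [] := integral_rsum measurable_jump sum_jump_fin.
have E : (fun eta => rsum (jump ^~ eta)) = generator p g f.
  by apply/funext => eta; rewrite generator_single_jump.
rewrite -E => i1 i2; split; first exact: i1.
by rewrite i2; congr rsum; apply/funext => xy; exact: integral_jump.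
Qed.

Lemma abs_summable_mean_flux : abs_summable (mean_flux f).
Proof.
apply: le_lt_trans sum_jump_fin; apply: le_esum => xy _.
rewrite -integral_jump; apply: (@le_trans _ _ `|\int[P]_eta (jump xy eta)%:E|%E).
  by rewrite /Rintegral; case: (integral _ _ _) => [r| |] /=; rewrite ?normr0 ?leey ?lexx.
apply: le_abse_integral => //; apply/measurable_EFinP; exact: measurable_jump.
Qed.

End CylinderFunction.
End MeanGenerator.

(** * Detailed balance and sufficiency *)

Section SingleSite.
Variables (R : realType) (d : nat) (P : probability (config d) R).
Hypotheses (htrans : translation_invariant_measure P).
Local Notation mu := (marginal P).

Lemma prob_site (x : site d) n : P [set eta | eta x = n] = (mu n)%:E.
Proof.
rewrite -(@marginalE _ _ _ htrans x n) fineK //.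
by apply: fin_num_measure; exact: measurable_coordinate.
Qed.

Lemma measurable_site (x : site d) (k : nat -> R) :
  measurable_fun setT (fun eta : config d => k (eta x)).
Proof.
apply: (@measurable_depends_on _ _ _ [:: x]) => e z ez.
by rewrite ez // inE.
Qed.

Lemma integral_site (x : site d) (k : nat -> R) : (forall n, 0 <= k n) ->
  (\int[P]_eta (k (eta x))%:E)%E = \esum_(n in [set: nat]) (k n * mu n)%:E.
Proof.
move=> k0.
have mx n : measurable [set eta : config d | eta x = n] by exact: measurable_coordinate.
rewrite (integral_fibers mx) //; last exact: measurable_site.
apply: eq_esum => n _.
transitivity (\int[P]_eta ((k n)%:E * ((eta x == n)%:R)%:E))%E.
  apply: eq_integral => eta _; rewrite -EFinM; congr EFin.
  by case: eqP => [->|_]; rewrite ?mulr0.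
rewrite ge0_integralZl_EFin //; last first.
  by apply/measurable_EFinP; exact: (measurable_site x (fun m => (m == n)%:R)).
rewrite (@indicator_integral _ _ _ [set eta | eta x = n]) ?prob_site //.
by move=> eta; split => /eqP.
Qed.

End SingleSite.

Section DetailedBalance.
Variables (R : realType) (g : nat -> nat -> nat -> R) (mu : nat -> R).
Hypotheses (mu_gt0 : forall n, 0 < mu n)
  (hg1 : forall a, 0 < g 1 1 a) (hg0 : forall a, (1 <= a)%N -> 0 < g 1 a 0).

(** The jump from (a+1, b) to (a, b+1) and the one from (b+1, a) to (b, a+1) are
    reverse to each other up to the names of the two sites. *)
Definition detailed_balance : Prop := forall a b,
  g 1 a.+1 b * (mu a.+1 * mu b) = g 1 b.+1 a * (mu b.+1 * mu a).

(** The product form, read as the ratio of consecutive weights. *)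
Lemma product_form_rec : product_form g mu -> forall a,
  mu a.+1 = mu a * (mu 1%N / mu 0%N * (g 1 1 a / g 1 a.+1 0%N)).
Proof.
move=> h a.
have E n : mu n = mu 0%N * \prod_(1 <= k < n.+1) (mu 1%N / mu 0%N * (g 1 1 k.-1 / g 1 k 0%N)).
  by case: n => [|n]; [rewrite big_geq ?mulr1|exact: h].
by rewrite [LHS]E big_nat_recr //= mulrA -E.
Qed.

(** Both [product_form] and [symmetric_compatibility] express ratios by rates;
    their product is the ratio required by detailed balance. *)
Lemma detailed_balance_of_product : product_form g mu ->
  symmetric_compatibility g -> detailed_balance.
Proof.
move=> hp hs a b; rewrite (product_form_rec hp a) (product_form_rec hp b) (hs a b).
have n0 := lt0r_neq0 (mu_gt0 0); have na := lt0r_neq0 (hg1 a).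
have n1 := lt0r_neq0 (hg0 (ltn0Sn a)); have n2 := lt0r_neq0 (hg0 (ltn0Sn b)).
by field; rewrite n0 na n1 n2.
Qed.

(** Detailed balance at b = 0 determines mu(a+1) / mu(a), hence mu; with these
    ratios inserted, it becomes [symmetric_compatibility]. *)
Lemma product_of_detailed_balance : detailed_balance ->
  product_form g mu /\ symmetric_compatibility g.
Proof.
move=> h.
have rec a : mu a.+1 = mu a * (mu 1%N / mu 0%N * (g 1 1 a / g 1 a.+1 0%N)).
  have := h a 0%N; have n0 := lt0r_neq0 (mu_gt0 0).
  have n1 := lt0r_neq0 (hg0 (ltn0Sn a)) => e.
  apply: (mulfI n1); apply: (mulIf n0); rewrite -mulrA e.
  by field; rewrite n0 n1.
split.
  case=> // a _; elim: a => [|a IH]; first by rewrite big_nat1 -rec.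
  by rewrite big_nat_recr //= mulrA -IH -rec.
move=> a b; have e := h a b; rewrite (rec a) (rec b) in e.
have n0 := lt0r_neq0 (mu_gt0 0); have na := lt0r_neq0 (hg1 a).
have ma := lt0r_neq0 (mu_gt0 a); have mb := lt0r_neq0 (mu_gt0 b).
have m1 := lt0r_neq0 (mu_gt0 1).
have n1 := lt0r_neq0 (hg0 (ltn0Sn a)); have n2 := lt0r_neq0 (hg0 (ltn0Sn b)).
have nz : mu a * mu b * (mu 1%N / mu 0%N) * (g 1 1 a / g 1 a.+1 0%N) != 0.
  by rewrite !mulf_neq0 ?invr_eq0.
apply: (mulIf nz); rewrite [LHS](_ : _ = g 1 a.+1 b *
  (mu a * (mu 1%N / mu 0%N * (g 1 1 a / g 1 a.+1 0%N)) * mu b)); last by ring.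
by rewrite e; field; rewrite n0 na n1 n2.
Qed.

End DetailedBalance.

Section Sufficiency.
Variables (R : realType) (d : nat) (p : site d -> site d -> R).
Hypothesis hp : transition_kernel p.
Variable g : nat -> nat -> nat -> R.
Hypotheses (hg : mmp_rates g) (hMP : single_jump g).
Variable (P : probability (config d) R).
Hypotheses (hprod : product_measure P) (htrans : translation_invariant_measure P).
Local Notation mu := (marginal P).
Local Notation q eta x y := (g 1 (eta x) (eta y)).
Variable K : R.
Hypothesis hK : forall x y : site d, x != y -> (\int[P]_eta (q eta x y)%:E <= K%:E)%E.
Hypothesis hK0 : forall x : site d, (\int[P]_eta (g 1 (eta x) 0%N)%:E <= K%:E)%E.
Hypothesis balance : detailed_balance g mu.

Lemma integrable_exit x (h : config d -> R) B : measurable_fun setT h ->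
  (forall eta, `|h eta| <= B) ->
  P.-integrable setT (fun eta => (g 1 (eta x) 0%N * h eta)%:E).
Proof.
move=> mh hB.
have mq : measurable_fun setT (fun eta : config d => g 1 (eta x) 0%N).
  exact: (measurable_site x (fun n => g 1 n 0%N)).
apply: (@le_integrable _ _ _ P _ _ _ (fun eta => (B * g 1 (eta x) 0%N)%:E)) => //.
- by apply/measurable_EFinP; exact: measurable_funM.
- move=> eta _; rewrite /= lee_fin normrM mulrC; apply: le_trans (ler_norm _).
  by rewrite [`|g _ _ _|]ger0_norm ?rates_ge0 // ler_wpM2r // rates_ge0.
have : P.-integrable setT (fun eta => (g 1 (eta x) 0%N)%:E); last first.
  exact: integrableZl.
apply/integrableP; split; first exact/measurable_EFinP.
under eq_integral do rewrite gee0_abs ?lee_fin ?rates_ge0//.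
exact: (le_lt_trans (hK0 x)) (ltry _).
Qed.

Section NonnegativeFunction.
Variables (F : seq (site d)) (f : config d -> R) (B : R).
Hypotheses (fF : depends_on F f) (fB : forall eta, 0 <= f eta <= B).

Let fB' eta : `|f eta| <= B.
Proof. by case/andP: (fB eta) => f0 fb; rewrite ger0_norm. Qed.

Let mf : measurable_fun setT f := measurable_depends_on fF.

(** Reversing the jump moves the test function back to the configuration before
    the jump. *)
Lemma mean_flux_balanced x y : x != y -> mean_flux p g P f (x, y)
  = p x y * (\int[P]_eta (q eta y x * f eta) - \int[P]_eta (q eta x y * f eta)).
Proof.
move=> xy; rewrite /mean_flux /=; congr (_ * _).
have mS : measurable_fun setT (fun eta => f (migrate 1 x y eta)).
  exact: measurable_depends_on (@depends_on_migrate _ _ x y _ _ fF).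
transitivity (\int[P]_eta (q eta x y * f (migrate 1 x y eta) - q eta x y * f eta)).
  by apply: eq_Rintegral => eta _; rewrite mulrBr.
rewrite RintegralB //; last 2 first.
- by apply: (integrable_rate hg hK xy mS (B := B)) => eta; exact: fB'.
- exact: (integrable_rate hg hK xy mf fB').
congr (_ - _); rewrite /Rintegral (integral_reversal hprod htrans xy fF fB) //.
- by move=> a b; exact: rates_ge0.
- by move=> b; exact: rates_empty.
Qed.

(** By [mean_flux_balanced] the flux through (x, y) is opposite to the flux through
    (y, x). *)
Lemma rsum_mean_flux_symmetric : symmetric_kernel p -> rsum (mean_flux p g P f) = 0.
Proof.
move=> sp; apply: (@rsum_antisym _ _ _ (fun xy => (xy.2, xy.1))) => [[]//|[x y]] /=.
have [<-|xy] := eqVneq x y; first by rewrite mean_flux_diag oppr0.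
by rewrite !mean_flux_balanced // 1?eq_sym // sp; ring.
Qed.

(** The second compatibility condition makes the flux a transport of [phi], the
    covariance of the exit rate at a site and [f], which by independence vanishes
    away from the sites of [f]. *)
Lemma rsum_mean_flux_asymmetric : asymmetric_compatibility g ->
  rsum (mean_flux p g P f) = 0.
Proof.
move=> ac.
pose h (eta : config d) x := g 1 (eta x) 0%N.
have h0 eta x : 0 <= h eta x by exact: rates_ge0.
pose phi x := \int[P]_eta (h eta x * f eta) - \int[P]_eta h eta 0 * \int[P]_eta f eta.
have ih x : P.-integrable setT (fun eta => (h eta x * f eta)%:E).
  exact: (integrable_exit x mf fB').
have fint : (\int[P]_eta (f eta)%:E < +oo)%E.
  apply: (@le_lt_trans _ _ (\int[P]_eta B%:E)%E).
    apply: ge0_le_integral => //.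
    - by move=> eta _; rewrite lee_fin (andP (fB _)).1.
    - exact/measurable_EFinP.
    - by move=> eta _; rewrite lee_fin (andP (fB _)).2.
  by rewrite integral_probability_cst ltry.
rewrite -(@rsum_transport _ _ _ hp (undup F) phi).
- congr rsum; apply/funext => -[x y] /=.
  have [<-|xy] := eqVneq x y; first by rewrite mean_flux_diag subrr mulr0.
  rewrite mean_flux_balanced //; congr (_ * _).
  have -> : phi y - phi x
      = \int[P]_eta (h eta y * f eta) - \int[P]_eta (h eta x * f eta) by rewrite /phi; ring.
  have iq x' y' : x' != y' -> P.-integrable setT (fun eta => (q eta x' y' * f eta)%:E).
    by move=> xy'; exact: (integrable_rate hg hK xy' mf fB').
  have yx : y != x by rewrite eq_sym.
  rewrite -(RintegralB measurableT (iq _ _ yx) (iq _ _ xy)).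
  rewrite -(RintegralB measurableT (ih y) (ih x)).
  apply: eq_Rintegral => eta _; rewrite /h (ac (eta x) (eta y)); ring.
- exact: undup_uniq.
- move=> x; rewrite mem_undup => xF; rewrite /phi /Rintegral.
  have u : uniq ([:: x] ++ undup F) by rewrite /= mem_undup xF undup_uniq.
  have hx : depends_on [:: x] (h ^~ x) by move=> e z ez; rewrite /h ez // inE.
  have fu : depends_on (undup F) f.
    by apply: sub_depends_on fF => z; rewrite mem_undup.
  rewrite (integral_independent hprod htrans u hx fu) //; last first.
    by move=> eta; case/andP: (fB eta).
  have e z : (\int[P]_eta (h eta z)%:E)%E = \esum_(n in [set: nat]) (g 1 n 0%N * mu n)%:E.
    by rewrite (integral_site htrans z (k := fun n => g 1 n 0%N)) // => n; exact: rates_ge0.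
  rewrite !e fineM ?subrr //.
  + rewrite ge0_fin_numE; first by rewrite -(e 0); apply: le_lt_trans (hK0 0) (ltry _).
    by apply: esum_ge0 => n _; rewrite lee_fin mulr_ge0 ?rates_ge0 ?marginal_ge0.
  + rewrite ge0_fin_numE //; apply: integral_ge0 => eta _.
    by rewrite lee_fin (andP (fB _)).1.
Qed.

End NonnegativeFunction.

(** Adding [B] makes [f] nonnegative and does not change the generator. *)
Theorem integral_generator_eq0 F (f : config d -> R) B :
  depends_on F f -> (forall eta, `|f eta| <= B) ->
  (~ symmetric_kernel p -> asymmetric_compatibility g) ->
  \int[P]_eta generator p g f eta = 0.
Proof.
move=> fF fB cond; pose h eta := f eta + B.
have hF : depends_on F h by move=> e z ez; rewrite /h (fF e z ez).
have hB eta : 0 <= h eta <= B + B.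
  by have := fB eta; rewrite /h ler_norml lerD2r => /andP[h1 ->]; rewrite -lerBlDr sub0r h1.
have -> : \int[P]_eta generator p g f eta = \int[P]_eta generator p g h eta.
  apply: eq_Rintegral => eta _; rewrite !generator_single_jump //.
  by congr rsum; apply/funext => xy; rewrite /h; congr (_ * _); ring.
have hB' eta : `|h eta| <= B + B by case/andP: (hB eta) => h0 hb; rewrite ger0_norm.
rewrite (integral_generator hp hg hMP hK hF hB').2.
have [sp|nsp] := pselect (symmetric_kernel p).
  exact: (rsum_mean_flux_symmetric hF hB).
exact: (rsum_mean_flux_asymmetric hF hB (cond nsp)).
Qed.

End Sufficiency.

(** * Necessity *)

Section Necessity.
Variables (R : realType) (d : nat) (p : site d -> site d -> R).
Hypotheses (hd : (0 < d)%N) (hp : transition_kernel p).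
Variable g : nat -> nat -> nat -> R.
Hypotheses (hg : mmp_rates g) (hMP : single_jump g).
Variable (P : probability (config d) R).
Hypotheses (hprod : product_measure P) (htrans : translation_invariant_measure P).
Local Notation mu := (marginal P).
Hypothesis hpos : forall n, 0 < mu n.
Local Notation q eta x y := (g 1 (eta x) (eta y)).
Variable K : R.
Hypothesis hK : forall x y : site d, x != y -> (\int[P]_eta (q eta x y)%:E <= K%:E)%E.

(** A path from 0 to some other site has a step that moves; translate its start
    to 0. *)
Lemma exists_neighbour : exists2 z, z != 0 & 0 < p 0 z.
Proof.
have [w [w' [ww' pw]]] : exists w w', w != w' /\ 0 < p w w'.
  pose x0 : site d := const_mx 1.
  have x00 : x0 != 0.
    by apply/eqP => /matrixP /(_ 0 (Ordinal hd)); rewrite !mxE.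
  have [s] := tk_irreducible hp 0 x0.
  elim: s (0 : site d) x00 => [|w s IH] u /= x0u; first by move=> _ e; rewrite e eqxx in x0u.
  move=> /andP[puw ps] es; have [uw|uw] := eqVneq u w; last by exists u, w.
  by apply: (IH w) => //; rewrite -uw.
exists (w' - w); first by rewrite subr_eq0 eq_sym.
by have := tk_translation hp 0 (w' - w) w; rewrite add0r subrK => <-.
Qed.

Definition pair_mean (phi : nat -> nat -> R) : R :=
  fine (\esum_(ab in [set: nat * nat]) (phi ab.1 ab.2 * (mu ab.1 * mu ab.2))%:E).

(** The mean flux through a pair of distinct sites, divided by p(x, y), for a test
    function [u] of their two occupation numbers.  It is the same for all pairs,
    because the two sites are independent with law [mu]. *)
Definition pair_flux (u : nat -> nat -> R) : R :=
  pair_mean (fun a b => g 1 a b * u a.-1 b.+1) - pair_mean (fun a b => g 1 a b * u a b).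

Definition site_mean (v : nat -> R) : R :=
  fine (\esum_(n in [set: nat]) (v n * mu n)%:E).

Lemma site_mean_indicator b : site_mean (fun n => (n == b)%:R) = mu b.
Proof.
rewrite /site_mean (esum_single (i := b)) ?eqxx ?mul1r // => [n|n /negbTE ->].
  by rewrite lee_fin mulr_ge0 // marginal_ge0.
by rewrite mul0r.
Qed.

(** When the departure site is empty, the jump does not happen but its rate is 0. *)
Lemma rate_migrate (u : nat -> nat -> R) x y (eta : config d) : x != y ->
  q eta x y * u (migrate 1 x y eta x) (migrate 1 x y eta y)
  = q eta x y * u (eta x).-1 (eta y).+1.
Proof.
move=> xy; case e : (eta x) => [|n]; first by rewrite rates_empty // !mul0r.
by rewrite /migrate e /= xy eqxx [y == x]eq_sym (negbTE xy) eqxx subn1 addn1.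
Qed.

Lemma migrate_other x y z (eta : config d) : z != x -> z != y ->
  migrate 1 x y eta z = eta z.
Proof.
by move=> /negbTE zx /negbTE zy; rewrite /migrate; case: ifP => //= _; rewrite zx zy.
Qed.

Lemma depends_on_pair (U : Type) x y (phi : nat -> nat -> U) :
  depends_on [:: x; y] (fun eta : config d => phi (eta x) (eta y)).
Proof. by move=> e z ez; rewrite !ez // !inE eqxx ?orbT. Qed.

Lemma mean_flux_split x y (f : config d -> R) F : x != y ->
  depends_on F f -> (forall eta, 0 <= f eta <= 1) ->
  mean_flux p g P f (x, y) = p x y *
    (\int[P]_eta (q eta x y * f (migrate 1 x y eta)) - \int[P]_eta (q eta x y * f eta)).
Proof.
move=> xy fF fB; rewrite /mean_flux /=; congr (_ * _).
have fB' eta : `|f eta| <= 1 by case/andP: (fB eta) => f0 fb; rewrite ger0_norm.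
rewrite -RintegralB //.
- by apply: eq_Rintegral => eta _; rewrite mulrBr.
- apply: (@integrable_rate _ _ _ hg _ _ hK x y _ 1) => //.
  exact: measurable_depends_on (@depends_on_migrate _ _ x y _ _ fF).
- apply: (@integrable_rate _ _ _ hg _ _ hK x y _ 1) => //.
  exact: measurable_depends_on fF.
Qed.

Lemma Rintegral_pair x y (phi : nat -> nat -> R) : x != y -> (forall a b, 0 <= phi a b) ->
  \int[P]_eta phi (eta x) (eta y) = pair_mean phi.
Proof. by move=> xy phi0; rewrite /Rintegral integral_pair. Qed.

Lemma mean_flux_pair x y (u : nat -> nat -> R) : x != y -> (forall a b, 0 <= u a b <= 1) ->
  mean_flux p g P (fun eta => u (eta x) (eta y)) (x, y) = p x y * pair_flux u.
Proof.
move=> xy uB; have u0 a b : 0 <= u a b by case/andP: (uB a b).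
rewrite (mean_flux_split xy (@depends_on_pair _ x y u)) //; congr (_ * (_ - _)).
  rewrite -(@Rintegral_pair x y) // => [|a b]; last by rewrite mulr_ge0 ?rates_ge0.
  by apply: eq_Rintegral => eta _; rewrite rate_migrate.
by rewrite -(@Rintegral_pair x y) // => a b; rewrite mulr_ge0 ?rates_ge0.
Qed.

(** A third site is a spectator of the jump and factors out by independence. *)
Lemma mean_flux_pair_site x y z (u : nat -> nat -> R) (v : nat -> R) :
  x != y -> z != x -> z != y ->
  (forall a b, 0 <= u a b <= 1) -> (forall n, 0 <= v n <= 1) ->
  mean_flux p g P (fun eta => u (eta x) (eta y) * v (eta z)) (x, y)
  = p x y * pair_flux u * site_mean v.
Proof.
move=> xy zx zy uB vB.
have u0 a b : 0 <= u a b by case/andP: (uB a b).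
have v0 n : 0 <= v n by case/andP: (vB n).
have dep : depends_on [:: x; y; z] (fun eta : config d => u (eta x) (eta y) * v (eta z)).
  by move=> e e' ee; rewrite !ee // !inE eqxx ?orbT.
have fB (eta : config d) : 0 <= u (eta x) (eta y) * v (eta z) <= 1.
  case/andP: (uB (eta x) (eta y)) => ? ?; case/andP: (vB (eta z)) => ? ?.
  by rewrite mulr_ge0 //= mulr_ile1.
rewrite (mean_flux_split xy dep) // -mulrA; congr (_ * _); rewrite /pair_flux mulrBl.
have key (phi : nat -> nat -> R) : (forall a b, 0 <= phi a b) ->
   (forall a b, phi a b <= g 1 a b) ->
   \int[P]_eta (phi (eta x) (eta y) * v (eta z)) = pair_mean phi * site_mean v.
  move=> phi0 phiq; rewrite /Rintegral.
  have un : uniq ([:: x; y] ++ [:: z]).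
    by rewrite /= !inE negb_or xy eq_sym zx eq_sym zy.
  have dz : depends_on [:: z] (fun eta : config d => v (eta z)).
    by move=> e e' ee; rewrite ee // inE.
  have vfin : (\int[P]_eta (v (eta z))%:E < +oo)%E.
    apply: (@le_lt_trans _ _ (\int[P]_eta 1%:E)%E); last by rewrite integral_probability_cst ltry.
    apply: ge0_le_integral => //.
    - by move=> eta _; rewrite lee_fin.
    - by apply/measurable_EFinP; exact: measurable_depends_on dz.
    - by move=> eta _; rewrite lee_fin (andP (vB _)).2.
  rewrite (integral_independent hprod htrans un (@depends_on_pair _ x y phi) dz) //.
  rewrite fineM; last 2 first.
  - rewrite ge0_fin_numE; last by apply: integral_ge0 => eta _; rewrite lee_fin.
    apply: le_lt_trans (le_lt_trans (hK xy) (ltry _)).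
    apply: ge0_le_integral => //.
    + by move=> eta _; rewrite lee_fin.
    + by apply/measurable_EFinP; exact: measurable_depends_on (@depends_on_pair _ x y phi).
    + by apply/measurable_EFinP; exact: measurable_rate.
    + by move=> eta _; rewrite lee_fin.
  - by rewrite ge0_fin_numE //; apply: integral_ge0 => eta _; rewrite lee_fin.
  by rewrite integral_pair // (integral_site htrans z v0).
congr (_ - _).
  rewrite -key => [|a b|a b].
  - apply: eq_Rintegral => eta _; rewrite mulrA rate_migrate //.
    by rewrite (migrate_other _ zx zy).
  - by rewrite mulr_ge0 ?rates_ge0.
  - by apply: ler_piMr; rewrite ?rates_ge0 // (andP (uB _ _)).2.
rewrite -key => [|a b|a b].
- by apply: eq_Rintegral => eta _; rewrite mulrA.
- by rewrite mulr_ge0 ?rates_ge0.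
- by apply: ler_piMr; rewrite ?rates_ge0 // (andP (uB _ _)).2.
Qed.

Lemma mean_flux_away F (f : config d -> R) x y : depends_on F f ->
  x \notin F -> y \notin F -> mean_flux p g P f (x, y) = 0.
Proof.
move=> fF xF yF; rewrite /mean_flux /= /Rintegral integral0_eq ?mulr0 // => eta _.
by rewrite (fF _ _ (migrate_agree eta xF yF)) subrr mulr0.
Qed.

Lemma rsum_indicator (i : site d * site d) : 
  abs_summable (fun j => (j == i)%:R : R) /\ rsum (fun j => (j == i)%:R : R) = 1.
Proof.
have e : \esum_(j in [set: site d * site d]) ((j == i)%:R : R)%:E = 1%E.
  by rewrite (esum_single (i := i)) ?eqxx // => j /negbTE ->.
split; last by rewrite ge0_rsum ?e.
rewrite /abs_summable; under eq_esum do rewrite ger0_norm//.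
by rewrite e ltry.
Qed.

Definition occupies (x : site d) (a : nat) (eta : config d) : R := (eta x == a)%:R.

Hypothesis stationary : forall F (f : config d -> R), depends_on F f ->
  (forall eta, 0 <= f eta <= 1) -> \int[P]_eta generator p g f eta = 0.

Lemma stationary_flux F (f : config d -> R) : depends_on F f ->
  (forall eta, 0 <= f eta <= 1) ->
  abs_summable (mean_flux p g P f) /\ rsum (mean_flux p g P f) = 0.
Proof.
move=> fF fB.
have fB' eta : `|f eta| <= 1 by case/andP: (fB eta) => f0 fb; rewrite ger0_norm.
split; first exact: (abs_summable_mean_flux hp hg hK fF fB').
by rewrite -(integral_generator hp hg hMP hK fF fB').2; exact: (stationary fF fB).
Qed.

Let out_flux a := pair_flux (fun a' _ => (a' == a)%:R).
Let in_flux a := pair_flux (fun _ b' => (b' == a)%:R).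

Let ind01 (b : bool) : 0 <= (b%:R : R) <= 1.
Proof. by case: b; rewrite /= ?lexx ?ler01. Qed.

Let ind01M (b c : bool) : 0 <= (b%:R * c%:R : R) <= 1.
Proof. by case: b; case: c; rewrite /= ?mulr0 ?mul0r ?mulr1 ?lexx ?ler01. Qed.

(** Only jumps out of [x0] or into [x0] are seen, and their mean fluxes do not
    depend on the other end. *)
Lemma mean_flux_occupies x0 a x y : mean_flux p g P (occupies x0 a) (x, y) =
  p x y * (if x == y then 0 else if x == x0 then out_flux a
           else if y == x0 then in_flux a else 0).
Proof.
have [<-|xy] := eqVneq x y; first by rewrite mulr0 mean_flux_diag.
have [<-|xx0] := eqVneq x x0.
  exact: (@mean_flux_pair x y (fun a' _ => (a' == a)%:R)).
have [<-|yy0] := eqVneq y x0.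
  exact: (@mean_flux_pair x y (fun _ b' => (b' == a)%:R)).
rewrite (@mean_flux_away [:: x0]) ?mulr0 ?inE //.
by move=> e z ez; rewrite /occupies ez ?inE.
Qed.

Lemma depends_on_occupies x a : depends_on [:: x] (occupies x a).
Proof. by move=> e z ez; rewrite /occupies ez ?inE. Qed.

(** Stationarity for the indicator of eta(0) = a.  Up to the transport of the
    indicator of the origin, which has total 0, the flux is (out + in) p(x, y)
    over the jumps leaving the origin, and some such jump has positive
    probability. *)
Lemma flux_antisym a : in_flux a = - out_flux a.
Proof.
have [z z0 pz] := exists_neighbour.
have [sf] := stationary_flux (@depends_on_occupies 0 a) (fun eta => ind01 (eta 0 == a)).
pose A (xy : site d * site d) := p xy.1 xy.2 * ((xy.1 == 0) && (xy.2 != 0))%:R.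
pose T (xy : site d * site d) := p xy.1 xy.2 * (((xy.2 == 0)%:R : R) - (xy.1 == 0)%:R).
have sA : abs_summable A.
  apply: le_abs_summable (abs_summable_departures hp 0) => -[x y] /=.
  rewrite /A /= ger0_norm; last by rewrite mulr_ge0 ?(tk_ge0 hp).
  by apply: ler_wpM2l; rewrite ?(tk_ge0 hp) //; case: (x == 0) (y == 0) => [] [].
have sT : abs_summable T.
  have := abs_summableD (abs_summable_arrivals hp 0)
    (abs_summableZ (-1) (abs_summable_departures hp 0)).
  by congr abs_summable; apply/funext => xy; rewrite /T; ring.
have rT : rsum T = 0.
  rewrite -(@rsum_transport _ _ _ hp [:: 0] (fun x => (x == 0)%:R)) // => x.
  by rewrite inE => /negbTE ->.
have -> : mean_flux p g P (occupies 0 a)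
   = (fun xy => (out_flux a + in_flux a) * A xy + in_flux a * T xy).
  apply/funext => -[x y]; rewrite mean_flux_occupies /A /T /=.
  have [<-|xy] := eqVneq x y; first by case: (x == 0) => /=; ring.
  have [x0|x0] := eqVneq x 0; have [y0|y0] := eqVneq y 0 => /=; try ring.
  by rewrite x0 y0 eqxx in xy.
rewrite rsumD; [|exact: abs_summableZ|exact: abs_summableZ].
rewrite !rsumZ // rT mulr0 addr0 => /eqP; rewrite mulf_eq0 => /orP[|/eqP rA].
  by rewrite addrC addr_eq0 => /eqP.
exfalso; move: sA rA; rewrite /abs_summable ge0_rsum; last first.
  by move=> xy; rewrite /A mulr_ge0 // (tk_ge0 hp).
have A0 xy : 0 <= A xy by rewrite /A mulr_ge0 // (tk_ge0 hp).
under eq_esum do rewrite ger0_norm//.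
pose i0 : site d * site d := (0, z).
have : ((A i0)%:E <= \esum_(xy in [set: site d * site d]) (A xy)%:E)%E.
  apply: (@le_trans _ _ (\esum_(xy in [set i0]) (A xy)%:E)%E).
    by rewrite esum_set1 // lee_fin.
  by rewrite esum_mkcond; apply: le_esum => xy _; case: ifP; rewrite // lee_fin.
rewrite {1}/A /= eqxx z0 /= mulr1.
case: (esum _ _) => //= r; rewrite lee_fin => + _ r0.
by rewrite r0 leNgt pz.
Qed.

Let joint_flux a b := pair_flux (fun a' b' => (a' == a)%:R * (b' == b)%:R).

(** Stationarity for the indicator of eta(0) = a, eta(z) = b, corrected by the
    one-site indicators with the factors mu(b) and mu(a): a jump between one of
    the two sites and a third one contributes 0, since the other of the two
    sites factors out. *)
Lemma two_site_flux (z : site d) (a b : nat) : z != 0 ->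
  p 0 z * (joint_flux a b - mu b * out_flux a - mu a * in_flux b)
  + p z 0 * (joint_flux b a - mu b * in_flux a - mu a * out_flux b) = 0.
Proof.
move=> z0; pose f (eta : config d) := occupies 0 a eta * occupies z b eta.
have f_pair : depends_on [:: 0; z] f.
  by move=> e e' ee; rewrite /f /occupies !ee // !inE eqxx ?orbT.
have [sf rf] := stationary_flux f_pair (fun eta => ind01M (eta 0 == a) (eta z == b)).
have [s0 r0] := stationary_flux (@depends_on_occupies 0 a) (fun eta => ind01 (eta 0 == a)).
have [sz rz] := stationary_flux (@depends_on_occupies z b) (fun eta => ind01 (eta z == b)).
(* The fluxes left at the two surviving pairs. *)
pose A1 := p 0 z * (joint_flux a b - mu b * out_flux a - mu a * in_flux b).
pose A2 := p z 0 * (joint_flux b a - mu b * in_flux a - mu a * out_flux b).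
have [i1 j1] := rsum_indicator (0, z).
have [i2 j2] := rsum_indicator (z, 0).
have E : (fun xy => mean_flux p g P f xy + (- mu b * mean_flux p g P (occupies 0 a) xy
     + - mu a * mean_flux p g P (occupies z b) xy))
  = (fun xy => A1 * (xy == (0, z))%:R + A2 * (xy == (z, 0))%:R).
  apply/funext => -[x y]; rewrite !mean_flux_occupies !xpair_eqE.
  have [<-|xy] := eqVneq x y.
    rewrite mean_flux_diag !mulr0 !addr0.
    have -> : (x == 0) && (x == z) = false.
      by apply/negbTE/negP => /andP[/eqP -> /eqP e]; rewrite -e eqxx in z0.
    have -> : (x == z) && (x == 0) = false.
      by apply/negbTE/negP => /andP[/eqP -> /eqP e]; rewrite e eqxx in z0.
    by rewrite !mulr0 addr0.
  have fC : f = (fun eta : config d => (eta z == b)%:R * (eta 0 == a)%:R).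
    by apply/funext => eta; rewrite /f /occupies mulrC.
  have z0' : 0 != z by rewrite eq_sym.
  have [x0|x0] := eqVneq x 0.
    move: xy; rewrite x0 [0 == z]eq_sym (negbTE z0) /= => y0.
    have [yz|yz] := eqVneq y z.
      rewrite yz; rewrite [mean_flux _ _ _ f _](@mean_flux_pair 0 z
        (fun a' b' => (a' == a)%:R * (b' == b)%:R)) //.
      by rewrite /A1 /joint_flux mulr0 addr0 mulr1; ring.
    rewrite [mean_flux _ _ _ f _](@mean_flux_pair_site 0 y z (fun a' _ => (a' == a)%:R)
        (fun n => (n == b)%:R)) // 1?eq_sym // site_mean_indicator.
    by rewrite -[pair_flux _]/(out_flux a) /=; ring.
  have [xz|xz] := eqVneq x z.
    move: xy; rewrite xz => zy.
    have [y0|y0] := eqVneq y 0.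
      rewrite y0 [0 == z]eq_sym (negbTE z0) /= fC.
      rewrite [mean_flux _ _ _ _ _](@mean_flux_pair z 0
        (fun a' b' => (a' == b)%:R * (b' == a)%:R)) //.
      by rewrite /A2 /joint_flux mulr0 add0r mulr1; ring.
    rewrite fC [mean_flux _ _ _ _ _](@mean_flux_pair_site z y 0 (fun a' _ => (a' == b)%:R)
        (fun n => (n == a)%:R)) // 1?eq_sym // site_mean_indicator.
    by rewrite -[pair_flux _]/(out_flux b) /=; ring.
  rewrite /= !mulr0 addr0.
  have [y0|y0] := eqVneq y 0.
    rewrite y0 [0 == z]eq_sym (negbTE z0).
    rewrite [mean_flux _ _ _ f _](@mean_flux_pair_site x 0 z (fun _ b' => (b' == a)%:R)
        (fun n => (n == b)%:R)) // 1?eq_sym // site_mean_indicator.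
    by rewrite -[pair_flux _]/(in_flux a) /=; ring.
  have [yz|yz] := eqVneq y z.
    rewrite yz fC.
    rewrite [mean_flux _ _ _ _ _](@mean_flux_pair_site x z 0 (fun _ b' => (b' == b)%:R)
        (fun n => (n == a)%:R)) // 1?eq_sym // site_mean_indicator.
    by rewrite -[pair_flux _]/(in_flux b) /=; ring.
  rewrite (@mean_flux_away [:: 0; z] f x y f_pair) ?inE ?negb_or ?x0 ?xz ?y0 ?yz //.
  by ring.
have : rsum (fun xy => mean_flux p g P f xy + (- mu b * mean_flux p g P (occupies 0 a) xy
     + - mu a * mean_flux p g P (occupies z b) xy)) = 0.
  rewrite rsumD //; last by apply: abs_summableD; exact: abs_summableZ.
  rewrite rsumD; [|exact: abs_summableZ|exact: abs_summableZ].
  by rewrite !rsumZ // rf r0 rz !mulr0 !addr0.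
rewrite E rsumD; [|exact: abs_summableZ|exact: abs_summableZ].
by rewrite !rsumZ // j1 j2 !mulr1.
Qed.

Let w a b := g 1 a b * (mu a * mu b).

(** The indicator of (a, b) is entered from (a+1, b-1) and left from (a, b). *)
Lemma joint_fluxE a b :
  joint_flux a b = (if b is b'.+1 then w a.+1 b' else 0) - w a b.
Proof.
have mu0 := marginal_ge0 htrans.
congr (_ - _); last first.
  rewrite /pair_mean (esum_single (i := (a, b))) /= ?eqxx ?mulr1 ?mul1r // => [[a' b']|[a' b']] /=.
    by rewrite lee_fin !mulr_ge0 // rates_ge0.
  rewrite xpair_eqE negb_and => /orP[] /negbTE ->; by rewrite ?(mul0r, mulr0).
case: b => [|b]; rewrite /pair_mean.
  rewrite esum1 // => -[a' b'] _ /=; by rewrite !(mul0r, mulr0).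
rewrite (esum_single (i := (a.+1, b))) /= ?eqxx ?mulr1 ?mul1r // => [[a' b']|[a' b']] /=.
  by rewrite lee_fin !mulr_ge0 // rates_ge0.
rewrite xpair_eqE negb_and eqSS; case: a' => [|a'] /=; first by rewrite rates_empty // !mul0r.
by rewrite eqSS => /orP[] /negbTE ->; rewrite ?(mul0r, mulr0).
Qed.

(** The flux through a pair, minus the parts due to each site alone, after
    [flux_antisym]. *)
Let excess a b := joint_flux a b - mu b * out_flux a + mu a * out_flux b.

Lemma excess_eq z a b : z != 0 -> p 0 z * excess a b + p z 0 * excess b a = 0.
Proof.
move=> z0; rewrite -[RHS](two_site_flux a b z0) /excess !flux_antisym.
by ring.
Qed.

(** Exchanging [a] and [b] in [excess_eq] gives a second equation; the determinant
    of the system is p(0, z)^2 - p(z, 0)^2, which is nonzero for a suitable z. *)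
Lemma asymmetric_excess a b : ~ symmetric_kernel p -> excess a b = 0.
Proof.
move=> nsp.
have [z z0 pz] : exists2 z, z != 0 & p 0 z != p z 0.
  apply: contrapT => nz; apply: nsp => x y.
  have [->//|xy] := eqVneq x y.
  have e1 := tk_translation hp 0 (y - x) x; have e2 := tk_translation hp (y - x) 0 x.
  rewrite add0r subrK in e1; rewrite add0r subrK in e2; rewrite e1 e2.
  by apply: contrapT => /eqP h; apply: nz; exists (y - x); rewrite // subr_eq0 eq_sym.
have h1 := excess_eq a b z0; have h2 := excess_eq b a z0.
have s0 : p 0 z + p z 0 != 0.
  apply: contra pz => /eqP s0; have := tk_ge0 hp 0 z; have := tk_ge0 hp z 0 => p1 p2.
  by apply/eqP; lra.
have d0 : p 0 z - p z 0 != 0 by rewrite subr_eq0.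
have : (p 0 z + p z 0) * (p 0 z - p z 0) * excess a b = 0.
  have -> : (p 0 z + p z 0) * (p 0 z - p z 0) * excess a b
     = p 0 z * (p 0 z * excess a b + p z 0 * excess b a)
       - p z 0 * (p 0 z * excess b a + p z 0 * excess a b) by ring.
  by rewrite h1 h2 !mulr0 subrr.
by move/eqP; rewrite !mulf_eq0 (negbTE s0) (negbTE d0) /= => /eqP.
Qed.

Lemma joint_flux_antisym a b : joint_flux a b + joint_flux b a = 0.
Proof.
suff : excess a b + excess b a = 0 by move=> <-; rewrite /excess; ring.
have [sp|nsp] := pselect (symmetric_kernel p); last by rewrite !asymmetric_excess // addr0.
have [z z0 pz] := exists_neighbour.
have := excess_eq a b z0; rewrite (sp z 0) -mulrDr => /eqP.
by rewrite mulf_eq0 gt_eqF //= => /eqP.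
Qed.

(** On each line a + b = n, antisymmetry of the joint flux propagates the identity
    w(a+1, b) = w(b+1, a) from a to a+1, starting from w(0, b) = 0. *)
Theorem stationary_detailed_balance : detailed_balance g mu.
Proof.
have w0 b : w 0%N b = 0 by rewrite /w rates_empty // mul0r.
suff H a b : w a.+1 b = w b.+1 a by exact: H.
elim: a b => [|a IH] b.
  have := joint_flux_antisym 0 b.+1; rewrite !joint_fluxE w0.
  by rewrite subr0 sub0r => /eqP; rewrite subr_eq0 => /eqP.
have := joint_flux_antisym a.+1 b.+1; rewrite !joint_fluxE (IH b.+1).
by move=> h; apply/eqP; rewrite -subr_eq0 -h; apply/eqP; ring.
Qed.

(** Under detailed balance the joint flux is w(b, a) - w(a, b), so vanishing of the
    excess writes g^1_{b,a} - g^1_{a,b} as a difference of functions of [a] and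
    [b]; the case b = 0 identifies these functions. *)
Theorem stationary_asymmetric_compatibility :
  ~ symmetric_kernel p -> asymmetric_compatibility g.
Proof.
move=> nsp a b; have db := stationary_detailed_balance.
have W x y : joint_flux x y = w y x - w x y.
  rewrite joint_fluxE; case: y => [|y]; first by rewrite {2}/w rates_empty // mul0r.
  by congr (_ - _); exact: db.
have ex x y : w y x - w x y = mu y * out_flux x - mu x * out_flux y.
  by have := asymmetric_excess x y nsp; rewrite /excess W => h; lra.
have z x : g 1 x 0 = out_flux 0 / mu 0 - out_flux x / mu x.
  have := ex x 0%N; rewrite /w rates_empty // mul0r sub0r => h.
  have m0 := lt0r_neq0 (hpos 0); have mx := lt0r_neq0 (hpos x).
  apply: (mulIf (mulf_neq0 mx m0)); rewrite -[LHS]opprK h; field.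
  by rewrite m0 mx.
have ma := lt0r_neq0 (hpos a); have mb := lt0r_neq0 (hpos b).
have m0 := lt0r_neq0 (hpos 0).
apply: (mulIf (mulf_neq0 ma mb)); rewrite !z.
have := ex a b; rewrite /w => h.
apply: (@addIr _ (- (g 1 a b * (mu a * mu b)))).
rewrite [g 1 b a * _](_ : _ = g 1 b a * (mu b * mu a)); last by ring.
by rewrite h; field; rewrite ma mb m0.
Qed.

End Necessity.

(** * Configurations of finite norm *)

Section FiniteNorm.
Variables (R : realType) (d : nat) (p : site d -> site d -> R).
Variables (a : site d -> R) (M : R).
Hypotheses (hp : transition_kernel p) (ha : weight p a M).
Local Notation X := (finite_norm_configs a).
Implicit Types (eta zeta : config d) (f : config d -> R).

Let a_gt0 x : 0 < a x := weight_gt0 ha x.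
Let a_ge0 x : 0 <= a x := ltW (a_gt0 x).

Lemma config_norm_ge0 eta : (0 <= config_norm a eta)%E.
Proof. by apply: esum_ge0 => x _; rewrite lee_fin mulr_ge0. Qed.

Lemma config_norm_fin eta : X eta -> config_norm a eta \is a fin_num.
Proof. by move=> h; rewrite ge0_fin_numE // config_norm_ge0. Qed.

Lemma config_dist_ge0 eta zeta : (0 <= config_dist a eta zeta)%E.
Proof. by apply: esum_ge0 => x _; rewrite lee_fin mulr_ge0. Qed.

(** The sites with the first [n] codes: finite sets exhausting the lattice. *)
Definition window (n : nat) : seq (site d) := pmap pickle_inv (iota 0 n).

Lemma mem_window n (x : site d) : (x \in window n) = (pickle x < n)%N.
Proof.
rewrite /window mem_pmap; apply/mapP/idP => [[m]|h].
  rewrite mem_iota add0n => /= mn e.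
  by have := @pickle_invK (site d) m; rewrite -e /= => ->.
by exists (pickle x); rewrite ?mem_iota ?pickleK_inv.
Qed.

Definition trunc (n : nat) eta : config d :=
  fun x => if (pickle x < n)%N then eta x else 0%N.

Lemma depends_on_trunc (U : Type) n (f : config d -> U) :
  depends_on (window n) (fun eta => f (trunc n eta)).
Proof.
move=> e z ez; congr f; apply/funext => x; rewrite /trunc; case: ifP => // h.
by rewrite ez // mem_window.
Qed.

(** A configuration with finitely many occupied sites has finite norm. *)
Lemma trunc_finite n eta : X (trunc n eta).
Proof.
rewrite /finite_norm_configs /= /config_norm.
have h : abs_summable (fun x => \sum_(v <- undup (window n)) (eta v)%:R * a v * (x == v)%:R).
  apply: abs_summable_sum => v; rewrite /abs_summable (esum_single (i := v)) ?ltry // => x.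
  by move=> /negbTE ->; rewrite mulr0 normr0.
apply: le_lt_trans h; apply: le_esum => x _; rewrite lee_fin; apply: le_trans (ler_norm _).
have t0 v : 0 <= (eta v)%:R * a v * (x == v)%:R by rewrite !mulr_ge0.
rewrite /trunc -mem_window; case: ifP => xF; last first.
  by rewrite mul0r; apply: sumr_ge0.
rewrite (bigD1_seq x) ?undup_uniq ?mem_undup //= eqxx mulr1.
by apply: ler_wpDr => //; apply: sumr_ge0.
Qed.

Lemma migrate_le x y eta z : (migrate 1 x y eta z <= eta z + (z == y))%N.
Proof.
rewrite /migrate; case: ifP => _; last by rewrite leq_addr.
case: (z =P x) => [->|_]; first by rewrite (leq_trans (leq_subr _ _)) // leq_addr.
by case: (z =P y) => [->|_]; rewrite ?addn0 // eqxx.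
Qed.

Lemma esum_point (v : site d) (c : R) : 0 <= c ->
  \esum_(z in [set: site d]) ((z == v)%:R * c)%:E = c%:E.
Proof.
move=> c0; rewrite (esum_single (i := v)) ?eqxx ?mul1r // => [z|z /negbTE ->].
  by rewrite lee_fin mulr_ge0.
by rewrite mul0r.
Qed.

Lemma migrate_finite x y eta : X eta -> X (migrate 1 x y eta).
Proof.
rewrite /finite_norm_configs /= /config_norm => h.
apply: (@le_lt_trans _ _ (\esum_(z in [set: site d])
   (((eta z)%:R * a z)%:E + ((z == y)%:R * a y)%:E))%E).
  apply: le_esum => z _; rewrite -EFinD lee_fin.
  have -> : (z == y)%:R * a y = (z == y)%:R * a z by case: eqP => [->|]; rewrite ?mul0r.
  by rewrite -mulrDl ler_wpM2r // -natrD ler_nat migrate_le.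
rewrite esumD ?esum_point //; last by move=> z _; rewrite lee_fin mulr_ge0.
  by rewrite lte_add_pinfty // ltry.
by move=> z _; rewrite lee_fin mulr_ge0.
Qed.

Lemma config_dist_migrate x y eta :
  (config_dist a (migrate 1 x y eta) eta <= (a x + a y)%:E)%E.
Proof.
rewrite EFinD -(esum_point x (a_ge0 x)) -(esum_point y (a_ge0 y)) -esumD; first last.
- by move=> z _; rewrite lee_fin mulr_ge0.
- by move=> z _; rewrite lee_fin mulr_ge0.
apply: le_esum => z _; rewrite -EFinD lee_fin /migrate.
case: ifP => [/andP[ex xy]|_]; last by rewrite subrr normr0 mul0r addr_ge0 // mulr_ge0.
case: (z =P x) => [->|zx].
  rewrite (negbTE xy) mul0r addr0 ler_wpM2r // natrB //.
  by rewrite addrAC subrr sub0r normrN normr1.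
case: (z =P y) => [->|zy]; last by rewrite subrr normr0 !mul0r addr0.
by rewrite mul0r add0r natrD addrAC subrr add0r normr1.
Qed.

Lemma config_dist_trunc n eta zeta :
  (config_dist a (trunc n eta) (trunc n zeta) <= config_dist a eta zeta)%E.
Proof.
apply: le_esum => x _; rewrite lee_fin ler_wpM2r // /trunc.
by case: ifP => // _; rewrite subrr normr0.
Qed.

(** Dominated convergence: the terms of the distance vanish one by one and are
    bounded by those of the norm. *)
Lemma dist_trunc_cvg eta : X eta -> config_dist a (trunc n eta) eta @[n --> \oo] --> 0%E.
Proof.
move=> hX; pose r n := rsum (fun x => `|((trunc n eta) x)%:R - (eta x)%:R| * a x).
have E n : config_dist a (trunc n eta) eta = (r n)%:E.
  rewrite /r ge0_rsum; last by move=> x; rewrite mulr_ge0.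
  rewrite fineK // ge0_fin_numE; last by apply: esum_ge0 => x _; rewrite lee_fin mulr_ge0.
  apply: le_lt_trans hX; apply: le_esum => x _; rewrite lee_fin ler_wpM2r //.
  rewrite /trunc; case: ifP => _; first by rewrite subrr normr0.
  by rewrite sub0r normrN ger0_norm.
under eq_fun do rewrite E.
apply: cvg_EFin; first exact: nearW.
rewrite -(@rsum_eq0 R (site d) (fun=> 0)) //.
apply: (@rsum_dominated _ _ _ _ (fun x => (eta x)%:R * a x)).
- move=> n x; rewrite ger0_norm ?mulr_ge0 // ler_wpM2r // /trunc.
  case: ifP => _; first by rewrite subrr normr0.
  by rewrite sub0r normrN ger0_norm.
- by rewrite /abs_summable; under eq_esum do rewrite ger0_norm ?mulr_ge0//.
move=> x; apply: cvg_near_cst; exists (pickle x).+1 => // n /= xn.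
by rewrite /trunc xn subrr normr0 mul0r.
Qed.

Lemma lipschitz_trunc_cvg f L eta : lipschitz_with a X f L -> X eta ->
  f (trunc n eta) @[n --> \oo] --> f eta.
Proof.
move=> fL hX; have fin n : config_dist a (trunc n eta) eta \is a fin_num.
  rewrite ge0_fin_numE ?config_dist_ge0 //; apply: le_lt_trans hX.
  apply: le_esum => x _; rewrite lee_fin ler_wpM2r // /trunc; case: ifP => _.
    by rewrite subrr normr0.
  by rewrite sub0r normrN ger0_norm.
apply/subr_cvg0/norm_cvg0P.
apply: (@squeeze_cvgr _ _ _ _ (fun=> 0) (fun n => L * fine (config_dist a (trunc n eta) eta))).
- apply: nearW => n; rewrite normr_ge0 /= -lee_fin EFinM fineK //.
  by apply: fL => //; exact: trunc_finite.
- exact: cvg_cst.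
rewrite -(mulr0 L); apply: cvgMr; apply: fine_cvg.
exact: dist_trunc_cvg.
Qed.

Lemma measurable_config_norm : measurable_fun setT (config_norm a).
Proof.
apply: measurable_fun_esum => [x|x eta]; last by rewrite lee_fin mulr_ge0.
by apply/measurable_EFinP; exact: (measurable_site x (fun n => n%:R * a x)).
Qed.

Lemma measurable_finite_norm : measurable X.
Proof.
rewrite (_ : X = config_norm a @^-1` `]-oo%E, +oo%E[).
  by rewrite -[X in measurable X]setTI; apply: measurable_config_norm => //; exact: emeasurable_itv.
apply/seteqP; split => eta /=; rewrite in_itv /=; last by move=> /andP[].
by move=> h; rewrite h andbT (lt_le_trans _ (config_norm_ge0 eta)) // ltNy0.
Qed.

(** On configurations of finite norm, a Lipschitz function is the pointwise limit
    of the cylinder functions [f \o trunc n]. *)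
Lemma measurable_lipschitz f : lipschitz_functions a X f -> measurable_fun X f.
Proof.
move=> [L _ fL].
apply: (@measurable_fun_cvg _ _ _ _ (fun n eta => f (trunc n eta))) => [n|eta hX].
  apply: (@measurable_funS _ _ _ _ setT) => //.
  exact: measurable_depends_on (@depends_on_trunc _ n f).
exact: lipschitz_trunc_cvg fL hX.
Qed.

Section GeneratorBound.
Variable g : nat -> nat -> nat -> R.
Hypotheses (hg : mmp_rates g) (hMP : single_jump g).
Variable C : R.
Hypotheses (C_gt0 : 0 < C) (hC : forall m n, g 1 m n <= C * (m + n)%:R).

Let C_ge0 : 0 <= C := ltW C_gt0.

Lemma esum_pair_swap (F : site d -> site d -> \bar R) :
  (forall x y, 0 <= F x y)%E ->
  \esum_(xy in [set: site d * site d]) F xy.1 xy.2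
  = \esum_(y in [set: site d]) \esum_(x in [set: site d]) F x y.
Proof.
move=> F0; rewrite -(esum_pair (F := fun y x => F x y)) //.
have bij : set_bij [set: site d * site d] [set: site d * site d] (fun xy => (xy.2, xy.1)).
  by rewrite setTT_bijective; exists (fun xy => (xy.2, xy.1)) => -[].
by rewrite [RHS](@reindex_esum _ _ _ _ _ _ _ bij).
Qed.

Let p_ge0 x y : 0 <= p x y := tk_ge0 hp x y.

(** The four products of the expanded sum: the terms with occupation number and
    weight at the same site sum to the norm because rows and columns of [p] do
    to 1, the mixed ones are controlled by the defining inequality of the
    weight. *)
Lemma esum_activity eta :
  (\esum_(xy in [set: site d * site d])
     (p xy.1 xy.2 * ((eta xy.1 + eta xy.2)%:R * (a xy.1 + a xy.2)))%:E
   <= (2 + 2 * M)%:E * config_norm a eta)%E.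
Proof.
have M0 : 0 <= M := ltW (weight_bound_gt0 ha).
pose F1 x y := ((eta x)%:R * a x * p x y)%:E.
pose F2 x y := ((eta x)%:R * (p x y * a y))%:E.
pose F3 x y := ((eta y)%:R * (a x * p x y))%:E.
pose F4 x y := ((eta y)%:R * a y * p x y)%:E.
have [F10 F20 F30 F40] : [/\ forall x y, (0 <= F1 x y)%E, forall x y, (0 <= F2 x y)%E,
    forall x y, (0 <= F3 x y)%E & forall x y, (0 <= F4 x y)%E].
  by split=> x y; rewrite lee_fin !mulr_ge0.
have out x : (\esum_(y in [set: site d]) (p x y * a y)%:E <= (M * a x)%:E)%E.
  apply: le_trans (weight_bound ha x); rewrite leeDl //.
  by apply: esum_ge0 => y _; rewrite lee_fin mulr_ge0.
have inn x : (\esum_(y in [set: site d]) (a y * p y x)%:E <= (M * a x)%:E)%E.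
  apply: le_trans (weight_bound ha x); rewrite leeDr //.
  by apply: esum_ge0 => y _; rewrite lee_fin mulr_ge0.
have E1 : \esum_(xy in [set: site d * site d]) F1 xy.1 xy.2 = config_norm a eta.
  rewrite (esum_pair (F := F1)) //; apply: eq_esum => x _.
  under eq_esum do rewrite /F1 EFinM.
  by rewrite esumZl ?(tk_sum1 hp) ?mule1 ?mulr_ge0 // => y; rewrite lee_fin.
have E4 : \esum_(xy in [set: site d * site d]) F4 xy.1 xy.2 = config_norm a eta.
  rewrite (esum_pair_swap (F := F4)) //; apply: eq_esum => y _.
  under eq_esum do rewrite /F4 EFinM.
  by rewrite esumZl ?(esum_kernel_col hp) ?mule1 ?mulr_ge0 // => x; rewrite lee_fin.
have MN : (M%:E * config_norm a eta = \esum_(x in [set: site d]) ((eta x)%:R * (M * a x))%:E)%E.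
  rewrite -esumZl //; last by move=> x; rewrite lee_fin mulr_ge0.
  by apply: eq_esum => x _; rewrite -EFinM mulrCA.
have E2 : (\esum_(xy in [set: site d * site d]) F2 xy.1 xy.2 <= M%:E * config_norm a eta)%E.
  rewrite (esum_pair (F := F2)) // MN; apply: le_esum => x _.
  under eq_esum do rewrite /F2 EFinM.
  rewrite esumZl // => [|y]; last by rewrite lee_fin mulr_ge0.
  by rewrite EFinM lee_wpmul2l // lee_fin.
have E3 : (\esum_(xy in [set: site d * site d]) F3 xy.1 xy.2 <= M%:E * config_norm a eta)%E.
  rewrite (esum_pair_swap (F := F3)) // MN; apply: le_esum => y _.
  under eq_esum do rewrite /F3 EFinM.
  rewrite esumZl // => [|x]; last by rewrite lee_fin mulr_ge0.
  by rewrite EFinM lee_wpmul2l // lee_fin.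
rewrite (eq_esum (b := fun xy => F1 xy.1 xy.2 + F2 xy.1 xy.2
    + (F3 xy.1 xy.2 + F4 xy.1 xy.2))%E); last first.
  by move=> -[x y] _ /=; rewrite -!EFinD natrD; congr EFin; ring.
rewrite !esumD //; [|by move=> *; rewrite adde_ge0|by move=> *; rewrite adde_ge0].
rewrite E1 E4.
have -> : ((2 + 2 * M)%:E * config_norm a eta = config_norm a eta + M%:E * config_norm a eta
    + (M%:E * config_norm a eta + config_norm a eta))%E.
  have N0 := config_norm_ge0 eta.
  have MN0 : (0 <= M%:E * config_norm a eta)%E by rewrite mule_ge0.
  rewrite (_ : 2 + 2 * M = (1 + M) + (M + 1)); last by ring.
  by rewrite EFinD !ge0_muleDl ?lee_fin ?addr_ge0 // !EFinD !ge0_muleDl ?lee_fin // !mul1e.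
by rewrite leeD // leeD.
Qed.

(** A bound, up to a constant, of the effect of jumps from [xy.1] to [xy.2] on
    Lipschitz functions: rates grow linearly, and a jump moves the configuration
    by at most the two weights. *)
Definition activity eta (xy : site d * site d) : R :=
  p xy.1 xy.2 * ((eta xy.1 + eta xy.2)%:R * (a xy.1 + a xy.2)).

Lemma activity_ge0 eta xy : 0 <= activity eta xy.
Proof. by rewrite !mulr_ge0 // addr_ge0. Qed.

Lemma abs_summable_activity eta c : X eta -> abs_summable (fun xy => c * activity eta xy).
Proof.
move=> hX; apply: abs_summableZ; rewrite /abs_summable.
under eq_esum do rewrite ger0_norm ?activity_ge0//.
apply: le_lt_trans (esum_activity eta) _.
by rewrite -(fineK (config_norm_fin hX)) -EFinM ltry.
Qed.

Lemma jump_le_activity f L eta xy : 0 < L ->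
  `|f (migrate 1 xy.1 xy.2 eta) - f eta| <= L * (a xy.1 + a xy.2) ->
  `|p xy.1 xy.2 * g 1 (eta xy.1) (eta xy.2) * (f (migrate 1 xy.1 xy.2 eta) - f eta)|
  <= C * L * activity eta xy.
Proof.
move=> L0 fL; rewrite normrM ger0_norm; last by rewrite mulr_ge0 ?rates_ge0.
rewrite [leRHS](_ : _ = p xy.1 xy.2 * (C * (eta xy.1 + eta xy.2)%:R) * (L * (a xy.1 + a xy.2))).
  by apply: ler_pM => //; rewrite ?mulr_ge0 ?rates_ge0 // ler_wpM2l.
by rewrite /activity; ring.
Qed.

Lemma lipschitz_trunc_migrate f L n x y eta : 0 < L -> lipschitz_with a X f L ->
  `|f (trunc n (migrate 1 x y eta)) - f (trunc n eta)| <= L * (a x + a y).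
Proof.
move=> L0 fL; rewrite -lee_fin.
apply: le_trans (fL _ _ (trunc_finite n _) (trunc_finite n _)) _.
rewrite EFinM; apply: lee_wpmul2l; first by rewrite lee_fin ltW.
by apply: le_trans (config_dist_trunc _ _ _) _; exact: config_dist_migrate.
Qed.

Lemma generator_bound f L eta : 0 < L ->
  (forall x y, `|f (migrate 1 x y eta) - f eta| <= L * (a x + a y)) -> X eta ->
  `|generator p g f eta| <= C * L * (2 + 2 * M) * fine (config_norm a eta).
Proof.
move=> L0 fL hX; rewrite generator_single_jump //.
apply: (rsum_norm_le (G := fun xy => C * L * activity eta xy)) => [xy|].
  exact: jump_le_activity.
under eq_esum do rewrite EFinM.
have CL : 0 <= C * L by rewrite mulr_ge0 // ltW.
rewrite esumZl // => [|xy]; last by rewrite lee_fin activity_ge0.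
rewrite -mulrA [leRHS]EFinM; apply: lee_wpmul2l; first by rewrite lee_fin.
by rewrite [leRHS]EFinM fineK ?config_norm_fin // esum_activity.
Qed.

(** Truncation does not increase the Lipschitz constant, so [activity] dominates
    the sums that define the generators of all [f \o trunc n]. *)
Lemma generator_trunc_cvg f L eta : 0 < L -> lipschitz_with a X f L -> X eta ->
  generator p g (fun xi => f (trunc n xi)) eta @[n --> \oo] --> generator p g f eta.
Proof.
move=> L0 fL hX; rewrite generator_single_jump //.
under eq_fun do rewrite generator_single_jump //.
apply: (@rsum_dominated _ _ _ _ (fun xy => C * L * activity eta xy)).
- move=> n xy.
  by apply: (jump_le_activity (f := fun xi => f (trunc n xi))) => //;
    exact: lipschitz_trunc_migrate.
- exact: abs_summable_activity.
move=> xy; apply: cvgMr; apply: cvgB; apply: (lipschitz_trunc_cvg fL) => //.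
exact: migrate_finite.
Qed.

End GeneratorBound.

Section IntegrableNorm.
Variable (P : probability (config d) R).
Hypotheses (htrans : translation_invariant_measure P) (hmoment : finite_first_moment P).
Local Notation mu := (marginal P).

Definition first_moment : R := fine (\esum_(n in [set: nat]) (n%:R * mu n)%:E).

Lemma integral_occupation x : (\int[P]_eta ((eta x)%:R)%:E = first_moment%:E)%E.
Proof.
rewrite (integral_site htrans x (k := fun n => n%:R)) // /first_moment fineK //.
have mu0 := marginal_ge0 htrans.
rewrite ge0_fin_numE; last by apply: esum_ge0 => n _; rewrite lee_fin mulr_ge0.
rewrite -nneseries_esumT => [|n]; last by rewrite lee_fin mulr_ge0.
exact: hmoment.
Qed.

Lemma first_moment_ge0 : 0 <= first_moment.
Proof.
by rewrite -lee_fin -(integral_occupation 0); apply: integral_ge0 => eta _; rewrite lee_fin.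
Qed.

Lemma integrable_config_norm : P.-integrable setT (config_norm a).
Proof.
apply/integrableP; split; first exact: measurable_config_norm.
rewrite (eq_integral (config_norm a)); last by move=> eta _; rewrite gee0_abs // config_norm_ge0.
have msite x : measurable_fun setT (fun eta : config d => ((eta x)%:R * a x)%:E).
  by apply/measurable_EFinP; exact: (measurable_site x (fun n => n%:R * a x)).
rewrite ge0_integral_esum //; last by move=> x eta; rewrite lee_fin mulr_ge0.
rewrite (eq_esum (b := fun x => (first_moment%:E * (a x)%:E)%E)) => [|x _]; last first.
  under eq_integral do rewrite mulrC EFinM.
  rewrite ge0_integralZl_EFin //; first by rewrite integral_occupation muleC.
  by apply/measurable_EFinP; exact: (measurable_site x (fun n => n%:R)).
rewrite esumZl ?first_moment_ge0 //.
by rewrite lte_mul_pinfty ?lee_fin ?first_moment_ge0 // (weight_summable ha).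
Qed.

(** The norm has finite expectation, hence is finite almost surely. *)
Lemma finite_norm_prob1 : P X = 1%E.
Proof.
have mX := measurable_finite_norm.
have [N [mN N0 sub]] := integrable_ae measurableT integrable_config_norm.
have XC0 : P (~` X) = 0%E.
  apply: (subset_measure0 _ mN _ N0); first exact: measurableC.
  move=> eta nX; apply: sub => /= h; apply: nX.
  by have := h I; rewrite ge0_fin_numE // config_norm_ge0.
have := probability_setC P mX; rewrite XC0.
have : P X \is a fin_num by exact: fin_num_measure.
case: (P X) => // r _ /eqP; rewrite -EFinB eqe => /eqP h.
by congr EFin; lra.
Qed.

Lemma finite_norm_probC0 : P (~` X) = 0%E.
Proof.
by rewrite probability_setC ?finite_norm_prob1 ?subee //; exact: measurable_finite_norm.
Qed.

Lemma Rintegral_finite_norm (f : config d -> R) : P.-integrable setT (EFin \o f) ->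
  \int[P]_(eta in X) f eta = \int[P]_eta f eta.
Proof.
move=> fi; rewrite /Rintegral [in RHS](negligible_integral _ _ _ finite_norm_probC0) //.
  by rewrite setDE setTI setCK.
by apply: measurableC; exact: measurable_finite_norm.
Qed.

End IntegrableNorm.

End FiniteNorm.

(** * Limits of integrals and right derivatives *)

Section Calculus.
Variable R : realType.

Lemma Rintegral_dominated dsp (T : measurableType dsp) (mu : {measure set T -> \bar R})
    (D : set T) (f_ : nat -> T -> R) (f G : T -> R) : measurable D ->
  (forall n, measurable_fun D (f_ n)) ->
  (forall x, D x -> f_ n x @[n --> \oo] --> f x) ->
  mu.-integrable D (EFin \o G) ->
  (forall n x, D x -> `|f_ n x| <= G x) ->
  \int[mu]_(x in D) f_ n x @[n --> \oo] --> \int[mu]_(x in D) f x.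
Proof.
move=> mD mf ff iG fG.
have [|||||i1 _ i3] := @dominated_convergence _ T R mu D mD
  (fun n x => (f_ n x)%:E) (EFin \o f) (EFin \o G).
- by move=> n; apply/measurable_EFinP; exact: mf.
- apply/measurable_EFinP; exact: measurable_fun_cvg mf ff.
- by apply: aeW => x Dx /=; apply: cvg_EFin; [exact: nearW|exact: ff].
- exact: iG.
- by apply: aeW => x n Dx /=; rewrite lee_fin; exact: fG.
by apply: fine_cvg; rewrite fineK; [exact: i3|exact: integrable_fin_num].
Qed.

Lemma limit_of_zero (u : nat -> R) (l : R) : u n @[n --> \oo] --> l ->
  (forall n, u n = 0) -> l = 0.
Proof.
move=> ul u0; apply: (norm_cvg_unique ul).
by rewrite /= (_ : u = fun=> 0); [exact: cvg_cst|exact/funext].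
Qed.

(** Fix e > 0.  The times s in [0, T] with |F s - F 0| <= e s form a closed set;
    if its supremum were smaller than T, the vanishing right derivative would
    give a slightly later time in the set. *)
Lemma constant_of_right_derivative (F : R -> R) :
  (forall (t : R) (u : nat -> R), 0 <= t -> (forall n, 0 <= u n) ->
     u n @[n --> \oo] --> t -> F (u n) @[n --> \oo] --> F t) ->
  (forall t : R, 0 <= t ->
     (F (n.+1%:R^-1 + t) - F t) / n.+1%:R^-1 @[n --> \oo] --> 0) ->
  forall t : R, 0 <= t -> F t = F 0.
Proof.
move=> Fc Fd T T0.
suff H (e : R) : 0 < e -> `|F T - F 0| <= e * T.
  apply/eqP; rewrite -subr_eq0 -normr_le0; apply/ler_addgt0Pr => e e0; rewrite add0r.
  have T1 : 0 < T + 1 by rewrite ltr_wpDl.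
  apply: le_trans (H (e / (T + 1)) (divr_gt0 e0 T1)) _.
  by rewrite mulrAC ler_pdivrMr // ler_pM2l // lerDl.
move=> e0; pose A := [set s : R | 0 <= s <= T /\ `|F s - F 0| <= e * s].
have A0 : A 0 by split; rewrite ?lexx //= subrr normr0 mulr0.
have supA : has_sup A by split; [exists 0|exists T => s [/andP[]]].
pose s := sup A.
have s0 : 0 <= s by apply: ub_le_sup => //; case: supA.
have sT : s <= T by apply: ge_sup => [|r [/andP[]] //]; exists 0.
(* The supremum belongs to [A]: approach it from below within [A]. *)
have As : A s.
  split; first by rewrite s0.
  have [u hu] : {u : nat -> R & forall n, A (u n) /\ s - n.+1%:R^-1 < u n <= s}.
    apply: (@boolp.choice _ _ (fun n r => A r /\ s - n.+1%:R^-1 < r <= s)) => n.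
    have en : 0 < n.+1%:R^-1 :> R by rewrite invr_gt0.
    have [r Ar hr] := sup_adherent en supA.
    by exists r; split => //; rewrite hr /=; apply: ub_le_sup => //; case: supA.
  have us : u n @[n --> \oo] --> s.
    apply: (@squeeze_cvgr _ _ _ _ (fun n => s - n.+1%:R^-1) (fun=> s)).
    - by apply: nearW => n; have [_ /andP[h1 ->]] := hu n; rewrite ltW.
    - by rewrite -[X in _ --> X]subr0; apply: cvgB; [exact: cvg_cst|exact: cvg_harmonic].
    - exact: cvg_cst.
  have Fu : F (u n) @[n --> \oo] --> F s.
    by apply: Fc => // n; have [[/andP[]]] := hu n.
  apply: (@ler_cvg_to _ (nbhs \oo) _ _ (fun n => `|F (u n) - F 0|) (fun n => e * u n)).
  - by apply: cvg_norm; apply: cvgB; [exact: Fu|exact: cvg_cst].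
  - by apply: cvgMr.
  - by apply: nearW => n; have [[_]] := hu n.
have [<-|sT'] := eqVneq s T; first by case: As.
have {sT'}sT' : s < T by rewrite lt_neqAle sT'.
(* A step that stays below T and along which F grows with slope at most e. *)
have [n [hn1 hn2]] : exists n : nat, n.+1%:R^-1 <= T - s /\
    `|(F (n.+1%:R^-1 + s) - F s) / n.+1%:R^-1| <= e.
  have h1 : \forall n \near \oo, `|(F (n.+1%:R^-1 + s) - F s) / n.+1%:R^-1 : R| <= e.
    by have /cvgr0_norm_le := Fd s s0; apply.
  have h2 : \forall n \near \oo, (n.+1%:R^-1 : R) <= T - s.
    have /cvgr0_norm_le := @cvg_harmonic R; move/(_ (T - s)); rewrite subr_gt0 => /(_ sT').
    by apply: filterS => n /=; rewrite /harmonic /= ger0_norm.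
  by have [n [b1 b2]] := filter_ex (filterI h1 h2); exists n; split; [exact: b2|exact: b1].
have h0 : 0 < (n.+1%:R^-1 : R) by rewrite invr_gt0.
exfalso; have : A (n.+1%:R^-1 + s).
  split.
    by apply/andP; split; [rewrite addr_ge0 // ltW|rewrite -lerBrDr].
  move: hn2; rewrite normrM [X in _ * X]gtr0_norm ?invr_gt0 // ler_pdivrMr // => hn2.
  rewrite [X in `|X|](_ : _ = (F (n.+1%:R^-1 + s) - F s) + (F s - F 0)); last by ring.
  by apply: le_trans (ler_normD _ _) _; rewrite mulrDr lerD // As.2.
move=> An; have : n.+1%:R^-1 + s <= s by apply: ub_le_sup => //; case: supA.
by rewrite -subr_ge0 opprD addrCA subrr addr0 oppr_ge0 leNgt h0.
Qed.

End Calculus.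

(** * Invariance under the semigroup and the generator *)

Section Semigroup.
Variables (R : realType) (d : nat) (p : site d -> site d -> R).
Variables (a : site d -> R) (M : R).
Hypotheses (hp : transition_kernel p) (ha : weight p a M).
Variable g : nat -> nat -> nat -> R.
Hypotheses (hg : mmp_rates g) (hMP : single_jump g).
Variable C : R.
Hypotheses (C_gt0 : 0 < C) (hC : forall m n, g 1 m n <= C * (m + n)%:R).
Variable (P : probability (config d) R).
Hypotheses (htrans : translation_invariant_measure P) (hmoment : finite_first_moment P).
Variable S : R -> (config d -> R) -> config d -> R.
Hypothesis hS : mmp_semigroup p g a S.
Local Notation X := (finite_norm_configs a).
Local Notation D := (lipschitz_functions a X).
Implicit Types (eta zeta : config d) (f : config d -> R) (t : R).

Let mX : measurable X := measurable_finite_norm ha.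
Let markov := mmp_markov hS.

Lemma lipschitz_affine f s c : D f -> D (fun xi => s * f xi + c).
Proof.
move=> [L L0 fL]; exists (`|s| * L + 1); first by rewrite ltr_wpDl // mulr_ge0 // ltW.
move=> eta zeta hX zX; rewrite opprD addrACA subrr addr0 -mulrBr normrM.
have dge := config_dist_ge0 ha eta zeta.
have sL : 0 <= `|s| * L by rewrite mulr_ge0 // ltW.
rewrite EFinM EFinD ge0_muleDl ?lee_fin // mul1e.
apply: (@le_trans _ _ ((`|s| * L)%:E * config_dist a eta zeta)%E); last by rewrite leeDl.
by rewrite EFinM -muleA lee_wpmul2l ?lee_fin // fL.
Qed.

Lemma lipschitz_cst c : D (fun=> c).
Proof.
exists 1 => // eta zeta _ _; rewrite subrr normr0 mul1e.
exact: (config_dist_ge0 ha eta zeta).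
Qed.

Lemma semigroup_cst t c eta : 0 <= t -> X eta -> S t (fun=> c) eta = c.
Proof.
move=> t0 hX.
have S0 : S t (fun=> 0) eta = 0.
  have E : (fun _ : config d => -1 * 0 + 0 : R) = (fun=> 0).
    by apply/funext => xi; rewrite mulr0 addr0.
  have := ms_linear markov (-1) t0 (lipschitz_cst 0) (lipschitz_cst 0) hX.
  by rewrite E mulN1r addNr.
have E : (fun _ : config d => c * 1 + 0 : R) = (fun=> c).
  by apply/funext => xi; rewrite mulr1 addr0.
have := ms_linear markov c t0 (lipschitz_cst 1) (lipschitz_cst 0) hX.
by rewrite E S0 (ms_conservative markov t0 hX) mulr1 addr0.
Qed.

Lemma semigroup_affine t f s c eta : 0 <= t -> D f -> X eta ->
  S t (fun xi => s * f xi + c) eta = s * S t f eta + c.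
Proof.
move=> t0 fD hX.
by rewrite (ms_linear markov s t0 fD (lipschitz_cst c) hX) semigroup_cst.
Qed.

(** Positivity of [S t], applied to B - f and B + f. *)
Lemma semigroup_bounded t f B eta : 0 <= t -> D f ->
  (forall xi, X xi -> `|f xi| <= B) -> X eta -> `|S t f eta| <= B.
Proof.
move=> t0 fD fB hX; rewrite ler_norml -subr_ge0 opprK -[in X in _ && X]subr_ge0.
apply/andP; split.
  rewrite -[S t f eta]mul1r -semigroup_affine //.
  apply: (ms_positive markov t0 (lipschitz_affine 1 B fD)) => // xi /fB.
  by rewrite ler_norml mul1r -subr_ge0 opprK => /andP[].
rewrite addrC -mulN1r -semigroup_affine //.
apply: (ms_positive markov t0 (lipschitz_affine (-1) B fD)) => // xi /fB.
by rewrite ler_norml mulN1r addrC subr_ge0 => /andP[].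
Qed.

Lemma integrable_norm_bound k : P.-integrable X (fun eta => (k * fine (config_norm a eta))%:E).
Proof.
have h : P.-integrable X (fun eta => (k%:E * config_norm a eta)%E).
  apply: integrableZl => //; apply: (@integrableS _ _ _ P setT) => //.
  exact: (integrable_config_norm ha htrans hmoment).
apply: eq_integrable h => // eta /[!inE] hX.
by rewrite EFinM fineK // (config_norm_fin ha).
Qed.

Lemma integrable_bounded f B : D f -> (forall eta, X eta -> `|f eta| <= B) ->
  P.-integrable X (EFin \o f).
Proof.
move=> fD fB; apply: (@le_integrable _ _ _ P X mX _ (fun=> B%:E)).
- by apply/measurable_EFinP; exact: (measurable_lipschitz ha fD).
- by move=> eta hX /=; rewrite lee_fin; apply: le_trans (fB eta hX) (ler_norm _).
by apply: (@integrableS _ _ _ P setT) => //; exact: finite_measure_integrable_cst.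
Qed.

(** The modulus of continuity of the semigroup, with e^x - 1 <= x e^x. *)
Lemma difference_quotient_bound : exists2 k : R, 0 <= k & forall f L n eta, 0 < L ->
  lipschitz_with a X f L -> X eta ->
  `|(S n.+1%:R^-1 f eta - f eta) / n.+1%:R^-1| <= L * k * fine (config_norm a eta).
Proof.
have [c c0 modulus] := mmp_modulus hS; exists (c * expR c).
  by rewrite mulr_ge0 ?expR_ge0 // ltW.
move=> f L n eta L0 fL hX.
have h0 : 0 < (n.+1%:R^-1 : R) by rewrite invr_gt0.
have h1 : (n.+1%:R^-1 : R) <= 1 by rewrite invf_le1 // ler1n.
rewrite normrM [X in _ * X]gtr0_norm ?invr_gt0 // ler_pdivrMr //.
apply: le_trans (modulus _ _ _ _ (ltW h0) L0 fL hX) _.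
have N0 : 0 <= fine (config_norm a eta) by rewrite fine_ge0 // (config_norm_ge0 ha).
rewrite [leRHS](_ : _ = fine (config_norm a eta) * L * (c * n.+1%:R^-1 * expR c)); last by ring.
apply: ler_wpM2l; first by rewrite mulr_ge0 // ltW.
set x := c * _; have x0 : 0 <= x by rewrite mulr_ge0 // ltW.
apply: (@le_trans _ _ (x * expR x)).
  have := expR_ge1Dx (- x); rewrite expRN => h.
  have e0 := expR_gt0 x.
  have : (1 + - x) * expR x <= 1 by rewrite -ler_pdivlMr // div1r.
  by rewrite mulrBl mul1r; lra.
by rewrite ler_wpM2l // ler_expR /x ler_piMr // ltW.
Qed.

(** The norm is integrable and dominates the difference quotients. *)
Lemma integral_difference_quotient f : D f ->
  \int[P]_(eta in X) ((S n.+1%:R^-1 f eta - f eta) / n.+1%:R^-1) @[n --> \oo]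
  --> \int[P]_(eta in X) generator p g f eta.
Proof.
move=> fD; have [L L0 fL] := fD; have [k k0 hk] := difference_quotient_bound.
apply: (@Rintegral_dominated _ _ _ _ _ _ _ (fun eta => L * k * fine (config_norm a eta))) => //.
- move=> n; apply: measurable_funM; last exact: measurable_cst.
  apply: measurable_funB; last exact: (measurable_lipschitz ha fD).
  by apply: (measurable_lipschitz ha); apply: (ms_stable markov).
- move=> eta hX.
  have /cvg_at_rightP := mmp_derivative hS fD hX.
  move/(_ (fun n => n.+1%:R^-1)); apply; split => [n|]; first by rewrite invr_gt0.
  exact: cvg_harmonic.
- exact: integrable_norm_bound.
- by move=> n eta hX; exact: hk.
Qed.

Lemma integral_semigroup_continuous f B t (u : nat -> R) : D f ->
  (forall eta, X eta -> `|f eta| <= B) -> 0 <= t -> (forall n, 0 <= u n) ->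
  u n @[n --> \oo] --> t ->
  \int[P]_(eta in X) S (u n) f eta @[n --> \oo] --> \int[P]_(eta in X) S t f eta.
Proof.
move=> fD fB t0 u0 ut.
apply: (@Rintegral_dominated _ _ _ _ _ _ _ (fun=> B)) => //.
- by move=> n; apply: (measurable_lipschitz ha); apply: (ms_stable markov).
- move=> eta hX.
  have /subspace_continuousP h := mmp_continuous hS fD hX.
  have /h ht : `[0, +oo[%classic t by rewrite /= in_itv /= t0.
  apply: (cvg_comp u (fun s => S s f eta) _ ht).
  move=> V hV.
  have uV : \forall n \near \oo, `[0, +oo[%classic (u n) -> V (u n) := ut _ hV.
  by apply: filterS uV => n; apply; rewrite /= in_itv /= u0.
- by apply: (@integrableS _ _ _ P setT) => //; exact: finite_measure_integrable_cst.
- by move=> n eta hX; apply: (semigroup_bounded (u0 n) fD fB).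
Qed.

(** The difference quotients at time 0 have mean 0, and so has their limit. *)
Theorem stationary_of_invariant f B : invariant_measure a S P -> D f ->
  (forall eta, X eta -> `|f eta| <= B) -> \int[P]_(eta in X) generator p g f eta = 0.
Proof.
move=> [_ inv] fD fB.
have h := integral_difference_quotient fD.
apply: (limit_of_zero h) => n; have h0 : 0 <= (n.+1%:R^-1 : R) by rewrite invr_ge0.
have iS : P.-integrable X (EFin \o S n.+1%:R^-1 f).
  apply: (@integrable_bounded _ B); first exact: (ms_stable markov).
  by move=> eta hX; exact: (semigroup_bounded h0 fD fB).
have if_ := integrable_bounded fD fB.
rewrite RintegralZr //; last exact: (integrableB mX iS if_).
rewrite RintegralB // /Rintegral (inv f fD _ _ h0) ?subrr ?mul0r //.
by exists B.
Qed.

(** By the semigroup property, the right derivative of t -> E(S(t) f) at s is the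
    mean of the generator on S(s) f, again bounded and Lipschitz. *)
Theorem invariant_of_stationary :
  (forall f B, D f -> (forall eta, X eta -> `|f eta| <= B) ->
     \int[P]_(eta in X) generator p g f eta = 0) -> invariant_measure a S P.
Proof.
move=> stat; split; first exact: (finite_norm_prob1 ha htrans hmoment).
move=> f fD [B fB] t t0.
have SD s : 0 <= s -> D (S s f) by move=> s0; apply: (ms_stable markov).
have SB s : 0 <= s -> forall eta, X eta -> `|S s f eta| <= B.
  by move=> s0 eta hX; exact: (semigroup_bounded s0 fD fB).
pose F s := \int[P]_(eta in X) S s f eta.
have Ft : F t = F 0.
  apply: constant_of_right_derivative => // [s u s0 u0 us|s s0].
    exact: (integral_semigroup_continuous fD fB s0 u0 us).
  rewrite -(stat (S s f) B (SD s s0) (SB s s0)).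
  rewrite (_ : (fun n => _) = (fun n => \int[P]_(eta in X)
    ((S n.+1%:R^-1 (S s f) eta - S s f eta) / n.+1%:R^-1))).
    exact: (integral_difference_quotient (SD s s0)).
  apply/funext => n; have h0 : 0 <= (n.+1%:R^-1 : R) by rewrite invr_ge0.
  have iS r : 0 <= r -> P.-integrable X (EFin \o S r f).
    by move=> r0; exact: (integrable_bounded (SD r r0) (SB r r0)).
  have hs0 : 0 <= n.+1%:R^-1 + s by rewrite addr_ge0.
  rewrite /F -RintegralB //; [|exact: iS|exact: iS].
  rewrite -RintegralZr //; last exact: (integrableB mX (iS _ hs0) (iS _ s0)).
  apply: eq_Rintegral => eta /[!inE] hX.
  by rewrite (ms_comp markov h0 s0 fD hX).
have E s : 0 <= s -> (\int[P]_(eta in X) (S s f eta)%:E = (F s)%:E)%E.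
  move=> s0; rewrite /F /Rintegral fineK //; apply: integrable_fin_num => //.
  exact: (integrable_bounded (SD s s0) (SB s s0)).
rewrite E // Ft -E //; apply: eq_integral => eta /[!inE] hX.
by rewrite (ms_id markov fD hX).
Qed.

(** Approximation by the cylinder functions [f \o trunc n], whose generators are
    dominated by a multiple of the norm. *)
Theorem lipschitz_generator_eq0 f B :
  (forall F (h : config d -> R) B', depends_on F h -> (forall eta, `|h eta| <= B') ->
     P.-integrable setT (fun eta => (generator p g h eta)%:E) /\
     \int[P]_eta generator p g h eta = 0) ->
  D f -> (forall eta, X eta -> `|f eta| <= B) ->
  \int[P]_(eta in X) generator p g f eta = 0.
Proof.
move=> stat [L L0 fL] fB.
pose f_ n := fun xi => f (trunc n xi).
have fF n : depends_on (window d n) (f_ n) by exact: depends_on_trunc.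
have fB' n xi : `|f_ n xi| <= B by apply: fB; exact: (trunc_finite ha).
have h : \int[P]_(eta in X) generator p g (f_ n) eta @[n --> \oo]
    --> \int[P]_(eta in X) generator p g f eta.
  apply: (@Rintegral_dominated _ _ _ _ _ _ _
    (fun eta => C * L * (2 + 2 * M) * fine (config_norm a eta))) => //.
  - move=> n; apply: (@measurable_funS _ _ _ _ setT) => //.
    by have [i _] := stat _ _ _ (fF n) (fB' n); apply/measurable_EFinP; exact: (measurable_int P i).
  - by move=> eta hX; exact: (generator_trunc_cvg hp ha hg hMP hC L0 fL hX).
  - exact: integrable_norm_bound.
  - move=> n eta hX; apply: (generator_bound hp ha hg hMP C_gt0 hC L0) => // x y.
    exact: (lipschitz_trunc_migrate ha n x y eta L0 fL).
apply: (limit_of_zero h) => n; have [i e] := stat _ _ _ (fF n) (fB' n).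
by rewrite (Rintegral_finite_norm ha htrans hmoment).
Qed.

(** Configurations that differ at a site of [F] are at distance at least the least
    weight on [F]. *)
Lemma lipschitz_depends_on F f : depends_on F f -> (forall eta, 0 <= f eta <= 1) -> D f.
Proof.
move=> fF fB.
have [e e0 he] : exists2 e : R, 0 < e & forall x, x \in F -> e <= a x.
  elim: F {fF} => [|x F [e e0 he]]; first by exists 1.
  exists (Num.min e (a x)); first by rewrite lt_min e0 (weight_gt0 ha).
  by move=> y; rewrite inE ge_min => /orP[/eqP ->|/he ->]; rewrite ?lexx ?orbT.
exists e^-1; first by rewrite invr_gt0.
move=> eta zeta _ _.
have [ag|] := pselect (agree_on F eta zeta).
  rewrite (fF _ _ ag) subrr normr0; apply: mule_ge0; last exact: (config_dist_ge0 ha).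
  by rewrite lee_fin invr_ge0 ltW.
move=> /existsNP[x /not_implyP[xF nx]].
apply: (@le_trans _ _ 1%E).
  rewrite lee_fin ler_norml; have := fB eta; have := fB zeta.
  by move=> /andP[? ?] /andP[? ?]; apply/andP; split; lra.
rewrite -[leLHS](_ : (e^-1%:E * e%:E = 1)%E); last by rewrite -EFinM mulVf // gt_eqF.
apply: lee_wpmul2l; first by rewrite lee_fin invr_ge0 ltW.
apply: (@le_trans _ _ (\esum_(z in [set x]) (`|(eta z)%:R - (zeta z)%:R| * a z)%:E)%E).
  have ax : 0 <= a x := ltW (weight_gt0 ha x).
  rewrite esum_set1 ?lee_fin ?mulr_ge0 //.
  apply: le_trans (he x xF) _; rewrite ler_peMl //.
  move/eqP: nx; rewrite neq_ltn => /orP[] lt.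
    by rewrite distrC -natrB ?(ltnW lt) // ger0_norm // ler1n subn_gt0.
  by rewrite -natrB ?(ltnW lt) // ger0_norm // ler1n subn_gt0.
rewrite esum_mkcond; apply: le_esum => z _; case: ifP => // _.
by rewrite lee_fin mulr_ge0 // ltW // (weight_gt0 ha).
Qed.

End Semigroup.

(** * The characterization *)

Section RateBounds.
Variables (R : realType) (d : nat) (g : nat -> nat -> nat -> R).
Hypothesis hg : mmp_rates g.
Variable (P : probability (config d) R).

Lemma single_rate_le_sum (c : nat -> R) m n : (forall k, 0 <= c k) ->
  c 1%N * g 1 m.+1 n <= \sum_(1 <= k < m.+2) c k * g k m.+1 n.
Proof.
move=> c0; rewrite big_ltn // lerDl.
by apply: sumr_ge0 => k _; rewrite mulr_ge0 ?rates_ge0.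
Qed.

Lemma linear_rate_bound : linear_growth g ->
  exists2 C : R, 0 < C & forall m n, g 1 m n <= C * (m + n)%:R.
Proof.
move=> [C C0 hC]; exists C => // -[|m] n.
  by rewrite rates_empty // mulr_ge0 // ltW.
apply: le_trans (hC m.+1 n (ltn0Sn m)); apply: le_trans (single_rate_le_sum m n (ler0n R)).
by rewrite mul1r.
Qed.

Lemma bounded_rate_bound : bounded_rates g -> exists2 C : R, 0 < C & forall m n, g 1 m n <= C.
Proof.
move=> [C C0 hC]; exists C => // -[|m] n; first by rewrite rates_empty // ltW.
apply: le_trans (hC m.+1 n); rewrite !big_ord_recl /= rates_k0 // add0r lerDl.
by apply: sumr_ge0 => k _; rewrite rates_ge0.
Qed.

Lemma integral_le_cst (h : config d -> R) (C : R) : measurable_fun setT h ->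
  (forall eta, 0 <= h eta <= C) -> (\int[P]_eta (h eta)%:E <= C%:E)%E.
Proof.
move=> mh hC; rewrite -(@integral_probability_cst _ _ P C).
have C0 : 0 <= C by case/andP: (hC (fun=> 0%N)); exact: le_trans.
apply: ge0_le_integral => //.
- by move=> eta _; rewrite lee_fin (andP (hC _)).1.
- exact/measurable_EFinP.
- by move=> eta _; rewrite lee_fin (andP (hC _)).2.
Qed.

Hypotheses (htrans : translation_invariant_measure P) (hmoment : finite_first_moment P).
Variable C : R.
Hypotheses (C0 : 0 < C) (hC : forall m n, g 1 m n <= C * (m + n)%:R).

(** With linear growth, the first moment bounds the mean jump rates. *)
Lemma integral_linear_rate (x y : site d) :
  (\int[P]_eta (g 1 (eta x) (eta y))%:E <= (C * (first_moment P + first_moment P))%:E)%E.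
Proof.
have mo z : measurable_fun setT (fun eta : config d => ((eta z)%:R : R)%:E).
  by apply/measurable_EFinP; exact: (measurable_site z (fun n => n%:R)).
apply: (@le_trans _ _ (\int[P]_eta (C%:E * ((eta x)%:R%:E + (eta y)%:R%:E)))%E).
  apply: ge0_le_integral => //.
  - by move=> eta _; rewrite lee_fin rates_ge0.
  - by apply/measurable_EFinP; exact: measurable_rate.
  - by apply: emeasurable_funM => //; exact: emeasurable_funD.
  - by move=> eta _; rewrite -EFinD -EFinM lee_fin -natrD.
rewrite ge0_integralZl_EFin //; last 3 first.
- by move=> eta _; rewrite adde_ge0 // lee_fin.
- exact: emeasurable_funD.
- exact: ltW.
by rewrite ge0_integralD // !(integral_occupation htrans hmoment) -EFinD -EFinM.
Qed.

Lemma integral_linear_exit (x : site d) :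
  (\int[P]_eta (g 1 (eta x) 0%N)%:E <= (C * (first_moment P + first_moment P))%:E)%E.
Proof.
have mo : measurable_fun setT (fun eta : config d => ((eta x)%:R : R)%:E).
  by apply/measurable_EFinP; exact: (measurable_site x (fun n => n%:R)).
apply: (@le_trans _ _ (\int[P]_eta (C%:E * (eta x)%:R%:E))%E).
  apply: ge0_le_integral => //.
  - by move=> eta _; rewrite lee_fin rates_ge0.
  - by apply/measurable_EFinP; exact: (measurable_site x (fun n => g 1 n 0%N)).
  - by apply: emeasurable_funM.
  - by move=> eta _; rewrite -EFinM lee_fin; have := hC (eta x) 0; rewrite addn0.
rewrite ge0_integralZl_EFin //; last exact: ltW.
rewrite (integral_occupation htrans hmoment) -EFinM lee_fin ler_wpM2l ?(ltW C0) //.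
by rewrite lerDl first_moment_ge0.
Qed.

End RateBounds.

Section Characterization.
Variables (R : realType) (d : nat) (p : site d -> site d -> R).
Hypotheses (hd : (0 < d)%N) (hp : transition_kernel p).
Variable g : nat -> nat -> nat -> R.
Hypotheses (hg : mmp_rates g) (hMP : single_jump g).
Hypotheses (hg1 : forall n, 0 < g 1 1 n) (hg0 : forall n, (1 <= n)%N -> 0 < g 1 n 0).
Variable (P : probability (config d) R).
Hypotheses (hprod : product_measure P) (htrans : translation_invariant_measure P).
Hypothesis hpos : forall n, 0 < marginal P n.
Variable K : R.
Hypothesis hK : forall x y : site d, x != y ->
  (\int[P]_eta (g 1 (eta x) (eta y))%:E <= K%:E)%E.
Hypothesis hK0 : forall x : site d, (\int[P]_eta (g 1 (eta x) 0%N)%:E <= K%:E)%E.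

Definition rate_conditions : Prop :=
  product_form g (marginal P) /\
  (symmetric_kernel p -> symmetric_compatibility g) /\
  (~ symmetric_kernel p -> symmetric_compatibility g /\ asymmetric_compatibility g).

Lemma conditions_of_stationary :
  (forall F (f : config d -> R), depends_on F f -> (forall eta, 0 <= f eta <= 1) ->
     \int[P]_eta generator p g f eta = 0) -> rate_conditions.
Proof.
move=> stat.
have db := stationary_detailed_balance hd hp hg hMP hprod htrans hK stat.
have [pf sc] := product_of_detailed_balance hpos hg1 hg0 db.
split => //; split => // nsp; split => //.
exact: (stationary_asymmetric_compatibility hd hp hg hMP hprod htrans hpos hK stat nsp).
Qed.

Lemma stationary_of_conditions : rate_conditions ->
  forall F (f : config d -> R) B, depends_on F f -> (forall eta, `|f eta| <= B) ->
  P.-integrable setT (fun eta => (generator p g f eta)%:E) /\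
  \int[P]_eta generator p g f eta = 0.
Proof.
move=> [pf [sc ac]] F f B fF fB.
have scomp : symmetric_compatibility g.
  by have [/sc|/ac[]] := pselect (symmetric_kernel p).
have db := detailed_balance_of_product hpos hg1 hg0 pf scomp.
split; first exact: (integral_generator hp hg hMP hK fF fB).1.
apply: (integral_generator_eq0 hp hg hMP hprod htrans hK hK0 db fF fB) => nsp.
exact: (ac nsp).2.
Qed.

End Characterization.

Theorem proposition3p6 (R : realType) (d : nat) (hd : (0 < d)%N)
    (p : site d -> site d -> R) (hp : transition_kernel p)
    (g : nat -> nat -> nat -> R) (hg : mmp_rates g) (hMP : single_jump g)
    (hgrowth : linear_growth g)
    (hg1 : forall alpha : nat, 0 < g 1%N 1%N alpha)
    (hg0 : forall alpha : nat, (1 <= alpha)%N -> 0 < g 1%N alpha 0%N)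
    (a : site d -> R) (M : R) (ha : weight p a M)
    (P : probability (config d) R)
    (hprod : product_measure P) (htrans : translation_invariant_measure P)
    (hpos : forall alpha : nat, 0 < marginal P alpha)
    (S : R -> (config d -> R) -> config d -> R) :
  let conditions :=
    product_form g (marginal P) /\
    (symmetric_kernel p -> symmetric_compatibility g) /\
    (~ symmetric_kernel p ->
       symmetric_compatibility g /\ asymmetric_compatibility g) in
  (mmp_semigroup p g a S -> finite_first_moment P ->
     (invariant_measure a S P <-> conditions)) /\
  (alternative_construction p g a S -> bounded_rates g ->
     (full_invariant_measure a S P <-> conditions)).
Proof.
move=> conditions; split.
- move=> hS hmoment; have [C C0 hC] := linear_rate_bound hg hgrowth.
  pose K := C * (first_moment P + first_moment P).
  have hK (x y : site d) : x != y -> (\int[P]_eta (g 1 (eta x) (eta y))%:E <= K%:E)%E.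
    by move=> _; exact: integral_linear_rate.
  have hK0 (x : site d) : (\int[P]_eta (g 1 (eta x) 0%N)%:E <= K%:E)%E.
    exact: integral_linear_exit.
  split=> [inv|cond].
    apply: (conditions_of_stationary hd hp hg hMP hg1 hg0 hprod htrans hpos hK).
    move=> F f fF fB.
    have fB' eta : `|f eta| <= 1 by case/andP: (fB eta) => f0 f1; rewrite ger0_norm.
    rewrite -(Rintegral_finite_norm ha htrans hmoment); last first.
      exact: (integral_generator hp hg hMP hK fF fB').1.
    apply: (stationary_of_invariant ha htrans hmoment hS inv (B := 1)) => //.
    exact: (lipschitz_depends_on ha fF fB).
  apply: (invariant_of_stationary ha htrans hmoment hS) => f B fD fB.
  apply: (lipschitz_generator_eq0 hp ha hg hMP C0 hC htrans hmoment _ fD fB).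
  exact: (stationary_of_conditions hp hg hMP hg1 hg0 hprod htrans hpos hK hK0 cond).
move=> [_ char] hbound; have [C C0 hC] := bounded_rate_bound hg hbound.
have hK (x y : site d) : x != y -> (\int[P]_eta (g 1 (eta x) (eta y))%:E <= C%:E)%E.
  move=> _; apply: integral_le_cst => [|eta]; first exact: measurable_rate.
  by rewrite rates_ge0 //= hC.
have hK0 (x : site d) : (\int[P]_eta (g 1 (eta x) 0%N)%:E <= C%:E)%E.
  apply: integral_le_cst => [|eta]; last by rewrite rates_ge0 //= hC.
  exact: (measurable_site x (fun n => g 1 n 0%N)).
rewrite char; split=> [stat|cond].
  apply: (conditions_of_stationary hd hp hg hMP hg1 hg0 hprod htrans hpos hK).
  move=> F f fF fB; rewrite /Rintegral stat //; last by exists F.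
  by exists 1 => eta _; case/andP: (fB eta) => f0 f1; rewrite ger0_norm.
move=> f [B fB] [F fF].
have fB' eta : `|f eta| <= B by exact: fB.
have [i e] := stationary_of_conditions hp hg hMP hg1 hg0 hprod htrans hpos hK hK0 cond fF fB'.
by rewrite -[LHS]fineK ?(integrable_fin_num _ i) // -/(Rintegral _ _ _) e.
Qed.
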